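(* Consider the geometric model of the Lorenz equations described in the context, with observation matrix $H=I_{3\times3}$ and observation errors uniform on $[-\epsilon,\epsilon]^3$, observed at times $t_i=ih$. Let $S_k$ be the support of the smoothing distribution of the geometric model based on the observations $Y_0,Y_1,\ldots,Y_k$. Then there are positive constants $h_{\max}$ and $\epsilon_{\max}$ such that for any $0<\epsilon\le\epsilon_{\max}$ and $0<h\le h_{\max}$, for Lebesgue almost every initial point $u\in\Lambda^{\mathrm{geo}}$, $$\sup_{v\in S_k}d\big(v,U(u,\epsilon)\big)\to0\quad\text{as }k\to\infty,\ \text{almost surely in the observations},$$ where $U(u,\epsilon)=\{v\in\mathbb R^3: v_1=u_1,\ v_3=u_3,\ |v_2-u_2|<2\epsilon\}$ and $d(v,U(u,\epsilon))=\inf_{w\in U(u,\epsilon)}\|v-w\|$.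
   Context: Geometric model. Parameters: $0<\lambda_3<\lambda_1<\lambda_2$ and $\theta$; put $\alpha=\lambda_3/\lambda_1$, $\beta=\lambda_2/\lambda_1$ and assume $\frac1{\sqrt2}<\alpha<1$, $\beta>\frac{\log 6}{\log 2}-1$, $\frac{2^\alpha}{\sqrt2\,\alpha}<\theta<2^\alpha$. Let $S=\{(u_1,u_2,1):|u_1|\le\frac12,|u_2|\le\frac12\}$, $S^*=\{u\in S:u_1\ne0\}$, $\Gamma=\{u\in S:u_1=0\}$. Linear phase: a path started at $u\in S$ follows $\Psi^{\mathrm{lin}}_t(u)=(u_1e^{\lambda_1t},u_2e^{-\lambda_2t},u_3e^{-\lambda_3t})$ until it reaches $\Sigma=\{|u_1|=1\}$. For $u\in S^*$ this happens at time $\tau_\Sigma(u)=\frac1{\lambda_1}\log(1/|u_1|)$ at the point $(\mathrm{sgn}(u_1),u_2|u_1|^\beta,|u_1|^\alpha)$; paths started on $\Gamma$ follow the linear flow forever and converge to the origin. Rotation phase: from the point $w=(\pm1,w_2,w_3)$ reached on $\Sigma$, with $r(s)=1-w_3+\left(\frac12-(\theta-1)w_3\right)\frac{s}{(3/2)\pi}$, the path for $0\le s\le\frac32\pi$ is $\Psi^{\mathrm{rot}}_s(w)=\left(1+r(s)\sin s,\ w_2-\frac14\frac{s}{(3/2)\pi},\ 1-r(s)\cos s\right)$ if $w_1=1$, and $\Psi^{\mathrm{rot}}_s(w)=\left(-1-r(s)\sin s,\ w_2+\frac14\frac{s}{(3/2)\pi},\ 1-r(s)\cos s\right)$ if $w_1=-1$.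 At $s=\frac32\pi$ the path is back in $S$ and the linear phase starts again. $\Lambda^{\mathrm{geo}}\subset\mathbb R^3$ is the union of all points on paths started in $S$ until their first return to $S$ (including the points on the non-returning paths started on $\Gamma$). $\Psi^{\mathrm{geo}}_t$ is the semigroup on $\Lambda^{\mathrm{geo}}$ obtained by concatenating the two phases, and $u(t):=\Psi^{\mathrm{geo}}_t(u)$, $v(t):=\Psi^{\mathrm{geo}}_t(v)$. Observations: $Y_i=u(t_i)+Z_i$ with $Z_i$ i.i.d. uniform on $[-\epsilon,\epsilon]^3$, $u$ the fixed true initial point. With a prior density $q$ on $\Lambda^{\mathrm{geo}}$, the smoothing distribution given $Y_0,\ldots,Y_k$ has density at $v\in\Lambda^{\mathrm{geo}}$ proportional to $q(v)\prod_{i=0}^k\eta(Y_i-v(t_i))$, $\eta$ the noise density; its support is the set where this is nonzero, i.e. $S_k=\{v\in\Lambda^{\mathrm{geo}}:q(v)>0,\ \|Y_i-v(t_i)\|_\infty\le\epsilon\text{ for }0\le i\le k\}$. The supremum over an empty set is taken to be $0$. *)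

(* Defs.v *)
From HB Require Import structures.
From mathcomp Require Import all_boot all_order all_algebra.
From mathcomp Require Import all_classical all_reals all_analysis.
Import Order.TTheory GRing.Theory Num.Theory.
Import numFieldNormedType.Exports.

Set Implicit Arguments.
Unset Strict Implicit.
Unset Printing Implicit Defensive.

Local Open Scope classical_set_scope.
Local Open Scope ring_scope.

(* On this product, `|u| is the maximum norm; the Euclidean norm is [enorm]. *)
Notation pt R := (R * R * R)%type (only parsing).

Definition c1 (R : realType) (u : pt R) : R := u.1.1.
Definition c2 (R : realType) (u : pt R) : R := u.1.2.
Definition c3 (R : realType) (u : pt R) : R := u.2.

Definition enorm (R : realType) (u : pt R) : R :=
  Num.sqrt (c1 u ^+ 2 + c2 u ^+ 2 + c3 u ^+ 2).

Definition dist_to (R : realType) (v : pt R) (A : set (pt R)) : R :=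
  inf [set enorm (v - w) | w in A].

(* R^3 with its Borel sigma-algebra; convertible to [pt R]. The library puts
   Lebesgue measure on [measurableTypeR R], not on R. *)
Notation mpt R :=
  (measurableTypeR R * measurableTypeR R * measurableTypeR R)%type
  (only parsing).

Definition leb3 (R : realType) : {measure set (mpt R) -> \bar R} :=
  ((@lebesgue_measure R \x @lebesgue_measure R) \x @lebesgue_measure R)%E.

Record lorenz_params (R : realType) := LorenzParams {
  lam1 : R; lam2 : R; lam3 : R; theta : R }.

Section GeometricModel.
Context (R : realType) (p : lorenz_params R).
Implicit Types (a u v w : pt R) (s t : R).

Definition alpha : R := lam3 p / lam1 p.
Definition beta : R := lam2 p / lam1 p.

Definition admissible : Prop :=
  [/\ [/\ 0 < lam3 p, lam3 p < lam1 p & lam1 p < lam2 p],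
      1 / Num.sqrt 2 < alpha /\ alpha < 1,
      ln 6 / ln 2 - 1 < beta
    & 2 `^ alpha / (Num.sqrt 2 * alpha) < theta p /\ theta p < 2 `^ alpha].

Definition cross_section : set (pt R) :=
  [set u | [/\ `|c1 u| <= 1/2, `|c2 u| <= 1/2 & c3 u = 1]].

Definition lin_flow t u : pt R :=
  (c1 u * expR (lam1 p * t), c2 u * expR (- lam2 p * t),
   c3 u * expR (- lam3 p * t)).

(* Only meaningful when c1 u != 0. *)
Definition tau_Sigma u : R := (lam1 p)^-1 * ln (1 / `|c1 u|).

Definition rot_end : R := 3/2 * pi.

Definition rot_radius w s : R :=
  1 - c3 w + (1/2 - (theta p - 1) * c3 w) * (s / rot_end).

(* Only used for c1 w = 1 and c1 w = -1. *)
Definition rot_flow s w : pt R :=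
  if c1 w == 1 then
    (1 + rot_radius w s * sin s, c2 w - 1/4 * (s / rot_end),
     1 - rot_radius w s * cos s)
  else
    (- 1 - rot_radius w s * sin s, c2 w + 1/4 * (s / rot_end),
     1 - rot_radius w s * cos s).

Definition return_time a : R := tau_Sigma a + rot_end.

(* The path started at a in the cross-section, up to its first return there. *)
Definition path_from a t : pt R :=
  if (c1 a == 0) || (t <= tau_Sigma a) then lin_flow t a
  else rot_flow (t - tau_Sigma a) (lin_flow (tau_Sigma a) a).

(* [on_path u (a, s)]: the path started at a in the cross-section passes through
   u at time s, not after its first return to the cross-section. *)
Definition on_path u : set (pt R * R) :=
  [set x | [/\ cross_section x.1, 0 <= x.2,
                c1 x.1 != 0 -> x.2 <= return_time x.1
              & path_from x.1 x.2 = u]].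

Definition Lambda : set (pt R) := [set u | exists x, on_path u x].

(* Concatenation of successive paths, allowing at most n returns. *)
Fixpoint flow_rec n t a : pt R :=
  if n is m.+1 then
    if (c1 a != 0) && (return_time a <= t)
    then flow_rec m (t - return_time a) (path_from a (return_time a))
    else path_from a t
  else path_from a t.

(* Every return time exceeds 3/2 * pi > 1, so that at most t returns take
   place up to time t and the bound on the number of returns is not reached. *)
Definition flow_from t a : pt R := flow_rec (Num.truncn t).+1 t a.

(* A point u of Lambda is reached at time s by the path started at some a in
   the cross-section. The pair (a, s) is unique except when u is a point of the
   cross-section where a path returns; then all choices give the same value for
   t >= 0. Outside Lambda the value is irrelevant. *)
Definition geo t u : pt R :=
  let x := xget (u, 0) (on_path u) in flow_from (x.2 + t) x.1.

(* Density of the uniform distribution on [-eps, eps]^3. *)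
Definition eta (eps : R) (z : pt R) : R :=
  if `|z| <= eps then ((2 * eps) ^+ 3)^-1 else 0.

Definition prior_density (q : pt R -> R) : Prop :=
  [/\ measurable_fun (Lambda : set (mpt R)) q, forall v, Lambda v -> 0 <= q v
    & (\int[@leb3 R]_(v in Lambda) (q v)%:E = 1)%E].

(* The normalizing constant of the smoothing density is omitted: it does not
   affect the support. *)
Definition smoothing_density (q : pt R -> R) (eps h : R) (Y : nat -> pt R)
    (k : nat) (v : pt R) : R :=
  q v * \prod_(0 <= i < k.+1) eta eps (Y i - geo (i%:R * h) v).

Definition smoothing_support (q : pt R -> R) (eps h : R) (Y : nat -> pt R)
    (k : nat) : set (pt R) :=
  [set v | Lambda v /\ smoothing_density q eps h Y k v != 0].

Lemma smoothing_supportE q eps h Y k : prior_density q -> 0 < eps ->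
  smoothing_support q eps h Y k =
  [set v | [/\ Lambda v, 0 < q v & forall i, (i <= k)%N ->
                 `|Y i - geo (i%:R * h) v| <= eps]].
Proof.
move=> [_ q0 _] e0; apply/seteqP; split => v /=.
  move=> [Lv]; rewrite mulf_eq0 negb_or => /andP[qv].
  rewrite prodf_seq_neq0 => /allP pr; split => //.
    by rewrite lt_neqAle eq_sym qv q0.
  move=> i ik; have := pr i; rewrite mem_index_iota ltnS ik => /(_ isT) /=.
  by rewrite /eta; case: ifP => //; rewrite eqxx.
move=> [Lv qv H]; split => //; apply: mulf_neq0; first by rewrite gt_eqF.
rewrite prodf_seq_neq0; apply/allP => i; rewrite mem_index_iota ltnS => /= ik.
by rewrite /eta H// invr_neq0// expf_neq0// mulf_neq0// gt_eqF.
Qed.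

Lemma lin_tau_Sigma u : 0 < lam1 p -> cross_section u -> c1 u != 0 ->
  lin_flow (tau_Sigma u) u =
  (Num.sg (c1 u), c2 u * `|c1 u| `^ beta, `|c1 u| `^ alpha).
Proof.
move=> l1 [_ _ u3] u0.
have n0 : 0 < `|c1 u| by rewrite normr_gt0.
have lnE : ln (1 / `|c1 u|) = - ln `|c1 u| by rewrite div1r lnV.
rewrite /lin_flow /tau_Sigma /powR !lnE gt_eqF// u3 mul1r /alpha /beta.
congr (_, _, _).
- rewrite mulrA divff ?gt_eqF// mul1r expRN lnK//.
  by rewrite {1}[c1 u]numEsg -mulrA divff ?mulr1// gt_eqF.
- by congr (_ * expR _); rewrite !mulNr mulrN mulrN opprK mulrA.
- by congr (expR _); rewrite !mulNr mulrN mulrN opprK mulrA.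
Qed.

End GeometricModel.

(* Mutually independent variables, each with density f with respect to
   Lebesgue measure on R^3. *)
Definition iid_with_density (R : realType) (d : measure_display)
    (Om : measurableType d) (P : probability Om R)
    (Z : nat -> {RV P >-> mpt R}) (f : pt R -> R) : Prop :=
  (forall (J : seq nat) (A : nat -> set (mpt R)),
      uniq J -> (forall j, measurable (A j)) ->
      P (\bigcap_(j in [set` J]) (Z j @^-1` A j)) =
      (\prod_(j <- J) P (Z j @^-1` A j))%E) /\
  (forall (j : nat) (A : set (mpt R)), measurable A ->
      P (Z j @^-1` A) = (\int[@leb3 R]_(z in A) (f z)%:E)%E).

Definition neighborhood_U (R : realType) (u : pt R) (eps : R) : set (pt R) :=
  [set v | [/\ c1 v = c1 u, c3 v = c3 u & `|c2 v - c2 u| < 2 * eps]].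

(* The supremum of a nonnegative function; adjoining 0 makes it 0 when the
   index set A is empty. *)
Definition sup_dist (R : realType) (A B : set (pt R)) : \bar R :=
  ereal_sup ([set 0%E] `|` [set (dist_to v B)%:E | v in A]).

(* Main.v *)
Require Import Defs.
From mathcomp Require Import all_boot all_order all_algebra.
From mathcomp Require Import all_classical all_reals all_analysis.
From mathcomp Require Import ring lra.
Import Order.TTheory GRing.Theory Num.Theory.
Import numFieldNormedType.Exports.
Set Implicit Arguments.
Unset Strict Implicit.
Unset Printing Implicit Defensive.
Local Open Scope classical_set_scope.
Local Open Scope ring_scope.

(** Almost surely, a point surviving the observations stays within distance
    2 eps of the true path u at the observation times, so the theorem is a
    statement about two paths of the flow that shadow each other, completed by
    one use of the randomness.

    Reading off a rotation. On a path, |c1| exceeds 1 only during a rotation,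
    at angles below pi, and the sign of c1 tells the lobe. If u is near the
    middle of a rotation (angle pi/2) at an observation time, a point of another
    path within 2 eps is therefore rotating in the same lobe, and the polar
    angle shows that its phase is almost the same ([match_phase]). Once two paths
    agree on one rotation, they agree on the next: whichever of the two reaches
    the middle of its next rotation first is observed there, and forces the
    other one to be there too ([match_step]). Hence a survivor visits the two
    lobes in the same order as u, up to a time that grows with the number of
    observations ([ev_itinerary]).

    Expansion. The first coordinates of the successive points on the
    cross-section are iterates of the map sgn(x) (theta |x|^alpha - 1/2), which
    expands by a factor greater than 1 on each of its two branches
    ([return_map_expanding], [expansion_gt1]). Equal itineraries of length N
    thus force the n-th section points to be exponentially close in N - n
    ([ev_close]). The return times, and so the delays between successive
    rotations, then agree in the limit, and the only remaining freedom is one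
    constant time shift ([ev_time_shift]) together with the contracting
    coordinate c2.

    The time shift. A small shift along the path moves every point by less than
    2 eps forever, so it cannot be excluded by distances alone. Near the middle
    of a rotation c3 increases at a rate bounded below ([rot_monotone]), so a
    positive shift d lowers the third coordinate of the survivor by some
    multiple of d at each of these times. Almost surely, the independent noise
    comes within this amount of either end of [-eps, eps] at one of them
    ([noise_loud]), and the survivor violates the constraint of that
    observation ([ev_time_shift0]). So the survivor and u meet the
    cross-section at asymptotically equal times ([ev_start]), and following the
    paths to time 0 gives the convergence of c1 and c3 ([recover_before],
    [recover_after]). The bound on c2 is the constraint of the first
    observation.

    Exceptional points. The argument needs u never to meet the line c1 = 0 of
    the cross-section, nor to lie on the surfaces where the two phases are
    joined. The starts whose orbit meets that line have their first coordinate
    in the countable range of [gamma_preimage], and the paths over one first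
    coordinate lie in the product of two Lipschitz plane curves with an interval,
    which is a null set ([curve_negligible], [generic_ae]). *)

(** * Elementary trigonometry and the parameters *)

Section Trig.
Context {R : realType}.
Implicit Types x y : R.

Lemma cos_diff x y : x < y -> exists2 c, c \in `]x, y[ & cos x - cos y = sin c * (y - x).
Proof.
move=> xy.
have D z : z \in `]x, y[ -> is_derive z 1 (@cos R) (- sin z).
  by move=> _; exact: is_derive_cos.
have C : {within `[x, y], continuous (@cos R)}.
  by apply: continuous_subspaceT => z; exact: continuous_cos.
have [c cxy E] := MVT xy D C.
exists c => //; rewrite -opprB E; ring.
Qed.

Lemma sin_le_id x : 0 <= x -> sin x <= x.
Proof.
rewrite le_eqVlt => /predU1P[<-|x0]; first by rewrite sin0.
have D z : z \in `]0, x[ -> is_derive z 1 (@sin R) (cos z).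
  by move=> _; exact: is_derive_sin.
have C : {within `[0, x], continuous (@sin R)}.
  by apply: continuous_subspaceT => z; exact: continuous_sin.
have [c _ E] := MVT x0 D C.
move: E; rewrite sin0 !subr0 => ->; rewrite ler_piMl ?(ltW x0)//; exact: cos_le1.
Qed.

Lemma norm_sin_le x : `|sin x| <= `|x|.
Proof.
wlog x0 : x / 0 <= x.
  move=> H; have [x0|x0] := leP 0 x; first exact: H.
  by rewrite -normrN -sinN -(normrN x); apply: H; rewrite oppr_ge0 ltW.
rewrite (ger0_norm x0) ler_norml sin_le_id// andbT.
have [x1|x1] := leP x 2; last first.
  apply: (le_trans _ (sin_geN1 x)); lra.
apply: (@le_trans _ _ 0); first lra.
by apply: sin_ge0_pi; rewrite x0 (le_trans x1 (pi_ge2 R)).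
Qed.

Lemma cos_ge_half x : `|x| <= 1 -> 1/2 <= cos x.
Proof.
move=> x1; have -> : x = (x / 2) *+ 2 by rewrite mulr2n; lra.
rewrite cos_mulr2n cos2sin2.
have x2 : `|x / 2| <= 1/2.
  by rewrite normrM [`|2^-1|]ger0_norm ?invr_ge0//; lra.
have h := le_trans (norm_sin_le (x/2)) x2.
have : sin (x/2) ^+ 2 <= (1/2)^+2.
  by rewrite -real_normK ?num_real// lerXn2r ?nnegrE//; lra.
rewrite (_ : (1/2)^+2 = 1/4 :> R); last by field.
by move=> hs; lra.
Qed.

Lemma sin_ge_half x : `|x - pi / 2| <= 1 -> 1/2 <= sin x.
Proof.
by move=> /cos_ge_half; rewrite cosBpihalf.
Qed.

Lemma sin_3pihalf : sin (3/2 * pi) = -1 :> R.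
Proof. by rewrite (_ : 3/2*pi = pi/2 + pi) ?sinDpi ?sin_pihalf//; lra. Qed.

Lemma cos_3pihalf : cos (3/2 * pi) = 0 :> R.
Proof. by rewrite (_ : 3/2*pi = pi/2 + pi) ?cosDpi ?cos_pihalf ?oppr0//; lra. Qed.

(** A small sine leaves two angles modulo 2 pi; the positive cosine
    selects the one near 0. *)
Lemma angle_small k x : 0 <= k <= pi/2 -> - pi <= x <= pi -> 0 < cos x -> `|sin x| <= sin k ->
  `|x| <= k.
Proof.
move=> /andP[k0 k1] /andP[x0 x1] cx sx.
wlog xp : x x0 x1 cx sx / 0 <= x.
  move=> H; have [?|xn] := leP 0 x; first exact: H.
  by rewrite -normrN; apply: H; rewrite ?cosN ?sinN ?normrN//; lra.
have xlt : x < pi/2.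
  rewrite ltNge; apply/negP => h.
  move: cx; rewrite ltNge -cos_pihalf.
  move: h; rewrite le_eqVlt => /predU1P[->|h]; first by rewrite lexx.
  rewrite ltW// ltr_cos// in_itv/=; have := pi_ge2 R; lra.
rewrite ger0_norm// leNgt; apply/negP => kx.
move: sx; rewrite leNgt => /negP; apply.
rewrite ger0_norm; last by apply: sin_ge0_pi; lra.
by rewrite ltr_sin// in_itv/=; have := pi_ge2 R; lra.
Qed.
End Trig.

Section Params.
Context (R : realType) (p : lorenz_params R).
Hypothesis hp : admissible p.
Local Notation al := (alpha p).
Local Notation be := (beta p).
Local Notation th := (theta p).
Implicit Types x y : R.

Lemma lam1_gt0 : 0 < lam1 p.
Proof. by case: hp => [[h1 h2 h3] _ _ _]; lra. Qed.
Lemma lam2_gt0 : 0 < lam2 p.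
Proof. by case: hp => [[h1 h2 h3] _ _ _]; lra. Qed.
Lemma lam3_gt0 : 0 < lam3 p.
Proof. by case: hp => [[h1 h2 h3] _ _ _]; lra. Qed.
Lemma alpha_gt0 : 0 < al.
Proof. by rewrite divr_gt0 ?lam3_gt0 ?lam1_gt0. Qed.
Lemma alpha_lt1 : al < 1.
Proof. by case: hp => _ []. Qed.
Lemma beta_gt0 : 0 < be.
Proof. by rewrite divr_gt0 ?lam2_gt0 ?lam1_gt0. Qed.
Lemma theta_gt0 : 0 < th.
Proof.
case: hp => _ _ _ [h _]; apply: le_lt_trans h.
by rewrite divr_ge0 ?powR_ge0// mulr_ge0 ?sqrtr_ge0 ?(ltW alpha_gt0).
Qed.


(** The height on Sigma of the paths starting on the boundary
    |c1| = 1/2, hence the largest possible one. *)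
Definition max_height : R := (1/2) `^ al.
(** The factor by which c2 is contracted along the paths starting on
    |c1| = 1/2. *)
Definition max_contraction : R := (1/2) `^ be.
(** A lower bound for the radius of every rotation: the initial
    radius 1 - w for the largest height w. *)
Definition min_radius : R := 1 - max_height.

Lemma half_powR a : (1/2 : R) `^ a = (2 `^ a)^-1.
Proof.
by rewrite div1r -powR_inv1// -powRrM mulN1r powRN.
Qed.

Lemma max_height_lt1 : max_height < 1.
Proof.
have -> : 1 = 1 `^ al :> R by rewrite powR1.
apply: gt0_ltr_powR; rewrite ?alpha_gt0 ?nnegrE//; lra.
Qed.
Lemma min_radius_gt0 : 0 < min_radius.
Proof. by rewrite subr_gt0 max_height_lt1. Qed.
Lemma max_height_ge : 1/2 <= max_height.
Proof. by rewrite ger1_powR ?(ltW alpha_lt1)//; lra. Qed.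
Lemma theta_max_height : th * max_height < 1.
Proof.
case: hp => _ _ _ [_ h]; rewrite /max_height half_powR ltr_pdivrMr ?powR_gt0//.
by rewrite mul1r.
Qed.
Lemma theta_lt2 : th < 2.
Proof.
have := theta_max_height; have := max_height_ge; have := theta_gt0; nra.
Qed.
(** This is the hypothesis on beta. The value 1/3 is what keeps the two
    lobes apart in the coordinate c2 after two thirds of a rotation. *)
Lemma max_contraction_lt : max_contraction < 1/3.
Proof.
rewrite /max_contraction half_powR -div1r ltr_pdivrMr ?powR_gt0//.
case: hp => _ _ h _.
have l2 : 0 < ln 2 :> R by rewrite ln_gt0// ltr1n.
have : ln 3 < be * ln 2.
  rewrite -ltr_pdivrMr//; apply: le_lt_trans h.
  rewrite (_ : 6 = 2 * 3 :> R); last by ring.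
  by rewrite lnM ?posrE// mulrDl divff ?gt_eqF//; lra.
rewrite -ln_powR => h'.
have : 3 < 2 `^ be by rewrite -ltr_ln ?posrE ?powR_gt0.
lra.
Qed.
Lemma max_contraction_ge0 : 0 <= max_contraction.
Proof. exact: powR_ge0. Qed.

Lemma powR_half_le a x : 0 < a -> `|x| <= 1/2 -> `|x| `^ a <= (1/2) `^ a.
Proof.
by move=> a0 x1; rewrite ge0_ler_powR ?(ltW a0)// ?nnegrE//; lra.
Qed.

(** The derivative of theta x^alpha at x = 1/2, where it is smallest since
    alpha < 1. *)
Definition expansion : R := th * (al * (1/2) `^ (al - 1)).

(** The lower bound on theta makes the factor even greater than the square
    root of 2. *)
Lemma expansion_gt1 : 1 < expansion.
Proof.
case: hp => _ _ _ [h _].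
move: h; rewrite ltr_pdivrMr; last by rewrite mulr_gt0 ?sqrtr_gt0// alpha_gt0.
move=> h; rewrite /expansion half_powR powRB; last by rewrite pnatr_eq0 implybT.
rewrite powRr1// invf_div.
have p0 : 0 < 2 `^ al :> R by rewrite powR_gt0.
have -> : th * (al * (2 / 2 `^ al)) = th * al * 2 / 2 `^ al.
  by field; rewrite gt_eqF.
rewrite ltr_pdivlMr// mul1r.
have s2 : Num.sqrt 2 < 2 :> R.
  have s0 : 0 <= Num.sqrt 2 :> R by exact: sqrtr_ge0.
  have sE : Num.sqrt 2 ^+ 2 = 2 :> R by rewrite sqr_sqrtr.
  nra.
have := theta_gt0; have := alpha_gt0 => a0 t0.
have ta : 0 < th * al by rewrite mulr_gt0.
apply: lt_trans h _.
by rewrite (_ : th * (Num.sqrt 2 * al) = th * al * Num.sqrt 2) ?ltr_pM2l//; ring.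
Qed.

(** By the mean value theorem: x^alpha is concave, so its slope on
    [x, y] is at least the slope at the right end of the section. *)
Lemma powR_diff x y : 0 < x -> x < y -> y <= 1/2 ->
  expansion * (y - x) <= th * (y `^ al - x `^ al).
Proof.
move=> x0 xy y1.
have D z : z \in `]x, y[ -> is_derive z 1 (fun z => z `^ al) (al * z `^ (al - 1)).
  rewrite in_itv/= => /andP[xz _].
  by apply: is_derive1_powR; exact: lt_trans xz.
have C : {within `[x, y], continuous (fun z => z `^ al)}.
  apply: derivable_within_continuous => z; rewrite in_itv/= => /andP[xz _].
  by apply: derivable_powR; rewrite in_itv/= andbT (lt_le_trans x0).
have [c cxy ->] := MVT xy D C.
move: cxy; rewrite in_itv/= => /andP[xc cy].
rewrite /expansion -(mulrA th) ler_pM2l ?theta_gt0// ler_pM2r ?subr_gt0//.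
rewrite ler_pM2l ?alpha_gt0//.
have c0 : 0 < c by apply: lt_trans xc.
rewrite -(opprB 1 al) !powRN lef_pV2 ?posrE ?powR_gt0//; try lra.
apply: ge0_ler_powR; rewrite ?nnegrE. all: try (have := alpha_lt1; lra).
Qed.
End Params.

(** * Paths, the return map and the flow *)

Section Paths.
Context (R : realType) (p : lorenz_params R).
Hypothesis hp : admissible p.
Local Notation al := (alpha p).
Local Notation be := (beta p).
Local Notation th := (theta p).
Local Notation tau := (tau_Sigma p).
Implicit Types (a b u v : pt R) (s t w x : R).

Definition sheet_height a : R := `|c1 a| `^ al.

(** [rot_radius] as a function of the height on Sigma, the only quantity of
    the starting point on which it depends. *)
Definition lobe_radius w s : R := 1 - w + (1/2 - (th - 1) * w) * (s / rot_end R).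

Lemma rot_end_gt0 : 0 < rot_end R.
Proof. by rewrite /rot_end mulr_gt0 ?pi_gt0//; lra. Qed.

Lemma tau_ge0 a : cross_section a -> 0 <= tau a.
Proof.
move=> [a1 _ _]; have l1 := lam1_gt0 hp.
rewrite /tau_Sigma mulr_ge0 ?invr_ge0 ?(ltW l1)//.
have [->|a0] := eqVneq (c1 a) 0; first by rewrite normr0 invr0 mulr0 ln0.
by rewrite ln_ge0// div1r invf_ge1 ?normr_gt0//; lra.
Qed.

Lemma sheet_height_le a : cross_section a -> sheet_height a <= max_height p.
Proof. by move=> [a1 _ _]; apply: powR_half_le => //; exact: alpha_gt0. Qed.

Lemma sheet_height_ge0 a : 0 <= sheet_height a.
Proof. exact: powR_ge0. Qed.

Lemma sgP (x : R) : x != 0 -> Num.sg x = 1 \/ Num.sg x = -1.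
Proof. by case: sgrP => // _ _; [left|right]. Qed.

(** The factor sgn(c1 a) treats both lobes at once. At t = tau a, where the
    definition still uses the linear phase, the two formulas agree. *)
Lemma path_rot a t : cross_section a -> c1 a != 0 -> tau a <= t ->
  let s := t - tau a in
  path_from p a t =
  (Num.sg (c1 a) * (1 + lobe_radius (sheet_height a) s * sin s),
   c2 a * `|c1 a| `^ be - Num.sg (c1 a) / 4 * (s / rot_end R),
   1 - lobe_radius (sheet_height a) s * cos s).
Proof.
move=> ca a0 tt s.
have rotE : rot_flow p s (lin_flow p (tau a) a) =
  (Num.sg (c1 a) * (1 + lobe_radius (sheet_height a) s * sin s),
   c2 a * `|c1 a| `^ be - Num.sg (c1 a) / 4 * (s / rot_end R),
   1 - lobe_radius (sheet_height a) s * cos s).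
  rewrite lin_tau_Sigma// ?(lam1_gt0 hp)// /rot_flow /c1/= -/(c1 a).
  rewrite /rot_radius /c3 /c2 /= -/(sheet_height a) -/(lobe_radius _ _) -/(c2 a).
  have [->|->] := sgP a0; rewrite ?eqxx.
    by rewrite !mul1r.
  rewrite (_ : (-1 == 1 :> R) = false); last by apply/eqP; lra.
  by congr (_, _, _); ring.
rewrite /path_from (negbTE a0)/=; case: ifPn => // tl.
have tE : t = tau a by apply/eqP; rewrite eq_le tl tt.
rewrite -rotE /s tE subrr lin_tau_Sigma// ?(lam1_gt0 hp)// /rot_flow.
rewrite /rot_radius /c1 /c2 /c3/= mul0r sin0 cos0 !mulr0 !addr0 subr0 !mulr1.
rewrite opprB addrC subrK.
case: eqP => [->//|]; have [->|->] := sgP a0 => //.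
by rewrite subr0.
Qed.

(** The radius is affine in s, from 1 - w to 3/2 - theta w, and both end values
    are controlled by theta 2^(-alpha) < 1. *)
Lemma lobe_radius_bounds w s : 0 <= w <= max_height p -> 0 <= s <= rot_end R ->
  min_radius p <= lobe_radius w s <= 3/2.
Proof.
move=> /andP[w0 w1] /andP[s0 s1].
have re := rot_end_gt0.
have : 0 <= s / rot_end R <= 1.
  by rewrite divr_ge0 ?(ltW re)//= ler_pdivrMr// mul1r.
rewrite /lobe_radius; set z := s / _ => /andP[z0 z1].
have W1 := max_height_lt1 hp; have W2 := max_height_ge hp; have T0 := theta_gt0 hp.
have TW := theta_max_height hp.
have tw : th * w <= 1 by apply: le_trans (ltW TW); rewrite ler_pM2l.
have tw0 : 0 <= th * w by rewrite mulr_ge0 ?(ltW T0).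
rewrite (_ : 1 - w + _ = (1 - z) * (1 - w) + z * (3/2 - th * w)); last by field.
rewrite /min_radius; apply/andP; split; nra.
Qed.

Lemma lobe_radius_diffs w s s' : 0 <= w <= max_height p ->
  exists2 k, `|k| <= 1/2 & lobe_radius w s' - lobe_radius w s = k * (s' - s).
Proof.
move=> /andP[w0 w1]; have re := rot_end_gt0.
exists ((1/2 - (th - 1) * w) / rot_end R); last first.
  by rewrite /lobe_radius; field; rewrite gt_eqF.
have W1 := max_height_lt1 hp; have T0 := theta_gt0 hp; have T2 := theta_lt2 hp.
have tw : -1 <= (th - 1) * w <= 1 by apply/andP; split; nra.
have re3 : 3 <= rot_end R by rewrite /rot_end; have := pi_ge2 R; lra.
rewrite normrM [`|_^-1|]ger0_norm ?invr_ge0 ?(ltW re)// ler_pdivrMr//.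
move: tw => /andP[t1 t2]; rewrite ler_norml; apply/andP; split; lra.
Qed.

Lemma lobe_radius_diffw w w' s : 0 <= s <= rot_end R ->
  `|lobe_radius w' s - lobe_radius w s| <= 2 * `|w' - w|.
Proof.
move=> /andP[s0 s1]; have re := rot_end_gt0.
have : 0 <= s / rot_end R <= 1.
  by rewrite divr_ge0 ?(ltW re)//= ler_pdivrMr// mul1r.
rewrite /lobe_radius; set z := s / _ => /andP[z0 z1].
rewrite (_ : _ - _ = - (1 + (th - 1) * z) * (w' - w)); last by ring.
rewrite normrM ler_wpM2r// normrN ler_norml.
have T0 := theta_gt0 hp; have T2 := theta_lt2 hp.
apply/andP; split; nra.
Qed.

Lemma return_time_ge a : cross_section a -> 3 <= return_time p a.
Proof.
move=> ca; rewrite /return_time; have := tau_ge0 ca.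
by rewrite /rot_end; have := pi_ge2 R; lra.
Qed.

Definition return_map a : pt R := path_from p a (return_time p a).

Lemma return_mapE a : cross_section a -> c1 a != 0 ->
  return_map a = (Num.sg (c1 a) * (th * sheet_height a - 1/2),
   c2 a * `|c1 a| `^ be - Num.sg (c1 a) / 4, 1).
Proof.
move=> ca a0; have re := rot_end_gt0.
rewrite /return_map path_rot//; last by rewrite /return_time lerDl ltW.
rewrite {1 2 3 4 5}/return_time addrAC subrr add0r.
rewrite /lobe_radius divff ?gt_eqF// /rot_end sin_3pihalf cos_3pihalf.
by congr (_, _, _); field.
Qed.

Lemma cross_section_return_map a : cross_section a -> c1 a != 0 -> cross_section (return_map a).
Proof.
move=> ca a0; rewrite return_mapE//; have [a1 a2 a3] := ca.
have w1 := sheet_height_le ca; have w0 := sheet_height_ge0 a.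
have TW := theta_max_height hp; have T0 := theta_gt0 hp.
have tw : th * sheet_height a <= 1.
  by apply: le_trans (ltW TW); rewrite ler_pM2l.
have tw0 : 0 <= th * sheet_height a by rewrite mulr_ge0 ?(ltW T0).
have sg1 : `|Num.sg (c1 a)| = 1 by rewrite normr_sg a0.
split; rewrite /c1 /c2 /c3/= -/(c1 a) -/(c2 a) //.
  by rewrite normrM sg1 !mul1r ler_norml; apply/andP; split; lra.
have b1 : `|c1 a| `^ be <= 1/3.
  have := max_contraction_lt hp; have := powR_half_le (beta_gt0 hp) a1; rewrite /max_contraction; lra.
have b0 := powR_ge0 `|c1 a| be.
have : `|c2 a * `|c1 a| `^ be| <= 1/6.
  rewrite normrM (ger0_norm b0); have := normr_ge0 (c2 a); nra.
by rewrite !ler_norml => /andP[c1' c2']; have [->|->] := sgP a0;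
  apply/andP; split; lra.
Qed.

Lemma path_from0 a : cross_section a -> path_from p a 0 = a.
Proof.
move=> ca; rewrite /path_from tau_ge0// orbT.
by rewrite /lin_flow !mulr0 expR0 !mulr1; case: a {ca} => [[]].
Qed.

(** Each return takes at least three units of time, so a bound on the
    number of returns that exceeds t is never reached. *)
Lemma flow_rec_enough n m t a : cross_section a -> t < n%:R -> t < m%:R ->
  flow_rec p n t a = flow_rec p m t a.
Proof.
have step0 k t' a' : cross_section a' -> t' < 0 ->
    flow_rec p k t' a' = path_from p a' t'.
  case: k => //= k ca t0; have := return_time_ge ca => r3.
  by rewrite leNgt (_ : t' < _) ?andbF//; lra.
elim: n m t a => [|n IH] m t a ca tn tm; first by rewrite !step0.
case: m tm => [tm|m tm]; first by rewrite !step0.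
rewrite /=; case: ifP => // /andP[a0 rt].
have r3 := return_time_ge ca.
move: tn tm; rewrite -!natr1 => tn tm.
by apply: IH; [exact: cross_section_return_map|lra|lra].
Qed.

Lemma flow_fromE n t a : cross_section a -> t < n%:R ->
  flow_from p t a = flow_rec p n t a.
Proof.
move=> ca tn; rewrite /flow_from; have [t0|t0] := leP 0 t.
  by apply: flow_rec_enough => //; have /andP[] := truncn_itv t0.
apply: flow_rec_enough => //; apply: lt_le_trans t0 _; exact: ler0n.
Qed.

Lemma flow_from_path t a : cross_section a -> (c1 a != 0 -> t < return_time p a) ->
  flow_from p t a = path_from p a t.
Proof.
move=> ca H; rewrite /flow_from /=; case: ifP => // /andP[a0].
by rewrite leNgt H.
Qed.

Lemma flow_from_return t a : cross_section a -> c1 a != 0 -> return_time p a <= t ->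
  flow_from p t a = flow_from p (t - return_time p a) (return_map a).
Proof.
move=> ca a0 rt; have cr := cross_section_return_map ca a0.
rewrite [LHS]/flow_from /= a0 rt/= -/(return_map a).
have r3 := return_time_ge ca.
have t0 : 0 <= t by lra.
symmetry; apply: flow_fromE => //.
have /andP[_] := truncn_itv t0; rewrite -natr1; lra.
Qed.

(** At the return time itself the flow has already moved on to the next
    path, whose initial point is the end of the present one. *)
Lemma flow_from_path_le t a : cross_section a -> (c1 a != 0 -> t <= return_time p a) ->
  flow_from p t a = path_from p a t.
Proof.
move=> ca H; have [a0|a0] := eqVneq (c1 a) 0.
  by apply: flow_from_path => //; rewrite a0 eqxx.
have := H a0; rewrite le_eqVlt => /predU1P[->|ht]; last exact: flow_from_path.
rewrite flow_from_return// subrr.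
have cr := cross_section_return_map ca a0.
by rewrite flow_from_path// ?path_from0// => _; have := return_time_ge cr; lra.
Qed.
End Paths.

(** * Matching the rotations of two paths *)

Lemma c1E (R : realType) (x y z : R) : c1 (x, y, z) = x. Proof. by []. Qed.
Lemma c2E (R : realType) (x y z : R) : c2 (x, y, z) = y. Proof. by []. Qed.
Lemma c3E (R : realType) (x y z : R) : c3 (x, y, z) = z. Proof. by []. Qed.
Lemma c1B (R : realType) (u v : pt R) : c1 (u - v) = c1 u - c1 v. Proof. by []. Qed.
Lemma c2B (R : realType) (u v : pt R) : c2 (u - v) = c2 u - c2 v. Proof. by []. Qed.
Lemma c3B (R : realType) (u v : pt R) : c3 (u - v) = c3 u - c3 v. Proof. by []. Qed.

Lemma pt_norm_le (R : realType) (u : pt R) (e : R) :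
  `|u| <= e <-> [/\ `|c1 u| <= e, `|c2 u| <= e & `|c3 u| <= e].
Proof.
case: u => [[x y] z]; rewrite !prod_normE /c1 /c2 /c3 /= !ge_max.
by split=> [/andP[/andP[]]|[-> -> ->]].
Qed.

(** The angle between two plane vectors given in polar form is recovered from
    their cross and scalar products, both of which are controlled by the
    coordinatewise distance. *)
Lemma polar_angle (R : realType) (m e k r r' f f' : R) :
  0 < m -> m <= r <= 3/2 -> m <= r' <= 3/2 ->
  6 * e < m ^+ 2 -> 16 * e <= m -> 6 * e <= m ^+ 2 * sin k -> 0 < k <= 1/16 ->
  pi / 2 <= f <= pi / 2 + k -> 0 <= f' <= 3/2 * pi ->
  `|r' * sin f' - r * sin f| <= 2 * e -> `|r' * cos f' - r * cos f| <= 2 * e ->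
  `|f' - f| <= k.
Proof.
move=> m0 /andP[r1 r2] /andP[r1' r2'] e1 e2 e3 /andP[k0 k1] /andP[f1 f2] /andP[f1' f2'] HA HB.
have pi2 := pi_ge2 R.
have rp : 0 < r by lra.
have rp' : 0 < r' by lra.
have sf : 1/2 <= sin f by apply: sin_ge_half; rewrite ger0_norm; lra.
have A1 : m / 2 <= r * sin f by clear -m0 r1 rp sf; nra.
have An : `|r * sin f| <= 3/2.
  by rewrite normrM ger0_norm; have := sin_max f; clear -r2 rp; nra.
have Bn : `|r * cos f| <= 3/2.
  by rewrite normrM ger0_norm; have := cos_max f; clear -r2 rp; nra.
have sf' : 0 < sin f'.
  rewrite -(pmulr_rgt0 _ rp'); move: HA; rewrite ler_norml => /andP[HA1 HA2].
  clear -HA1 A1 e2 m0; lra.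
have f'pi : f' < pi.
  rewrite ltNge; apply/negP => pf; move: sf'.
  rewrite (_ : f' = f' - pi + pi); last by ring.
  rewrite sinDpi oppr_gt0 ltNge sin_ge0_pi//.
  by clear -pf f2' pi2; lra.
have s1 : r * r' * sin (f' - f) =
   (r' * sin f' - r * sin f) * (r * cos f) - (r * sin f) * (r' * cos f' - r * cos f).
  by rewrite sinB; ring.
have s2 : r * r' * cos (f' - f) = r ^+ 2 +
   ((r' * sin f' - r * sin f) * (r * sin f) + (r * cos f) * (r' * cos f' - r * cos f)).
  rewrite cosB -[r^+2]mulr1 -(cos2Dsin2 f); ring.
have rr' : 0 < r * r' by rewrite mulr_gt0.
have rr'2 : m ^+ 2 <= r * r' by rewrite expr2 ler_pM// ltW.
have rr2 : m ^+ 2 <= r ^+ 2 by rewrite !expr2 ler_pM// ltW.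
have sk0 : 0 <= sin k by apply: sin_ge0_pi; clear -k0 k1 pi2; lra.
have prod x y : `|x| <= 2 * e -> `|y| <= 3/2 -> `|x * y| <= 3 * e.
  move=> hx hy; rewrite normrM (_ : 3 * e = 2 * e * (3/2)); last by field.
  by rewrite ler_pM.
apply: angle_small.
- by clear -k0 k1 pi2; lra.
- by clear -k1 f1 f2 f1' f'pi pi2; lra.
- rewrite -(pmulr_rgt0 _ rr') s2.
  have := prod _ _ HA An; have := prod _ _ HB Bn; rewrite [X in `|X| <= _ -> _]mulrC.
  rewrite !ler_norml => /andP[g1 _] /andP[g2 _].
  by clear -g1 g2 rr2 e1; lra.
- rewrite -(ler_pM2l rr') -{1}(ger0_norm (ltW rr')) -normrM s1.
  apply: le_trans (ler_normB _ _) _.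
  have := prod _ _ HA Bn; have := prod _ _ HB An; rewrite [X in `|X| <= _ -> _]mulrC.
  have : m ^+ 2 * sin k <= r * r' * sin k by rewrite ler_wpM2r.
  by clear -e3; lra.
Qed.

Lemma mulr_ge_half (R : realType) (m r s : R) :
  0 < m -> m <= r -> 1/2 <= s -> m / 2 <= r * s.
Proof. by nra. Qed.

Lemma mulr_geN (R : realType) (r s : R) :
  0 <= r -> r <= 3/2 -> -1 <= s -> - (3/2) <= r * s.
Proof. by nra. Qed.

Section Matching.
Context (R : realType) (p : lorenz_params R).
Hypothesis hp : admissible p.
Local Notation tau := (tau_Sigma p).
Implicit Types (a b u v : pt R) (s t w x T : R).

(** By definition of tau, |c1| reaches 1 exactly at the end of the linear
    phase. *)
Lemma lin_c1_le1 a t : c1 a != 0 -> t <= tau a -> `|c1 (lin_flow p t a)| <= 1.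
Proof.
move=> a0 ta; have l1 := lam1_gt0 hp.
have n0 : 0 < `|c1 a| by rewrite normr_gt0.
rewrite /lin_flow {1}/c1/= -/(c1 a) normrM (ger0_norm (expR_ge0 _)).
apply: (@le_trans _ _ (`|c1 a| * expR (ln `|c1 a|^-1))).
  rewrite ler_pM2l// ler_expR; move: ta; rewrite /tau_Sigma div1r mulrC.
  by rewrite ler_pdivlMr// mulrC.
by rewrite lnK ?posrE ?invr_gt0// divff// gt_eqF.
Qed.

(** The tolerance k on phases is small against the radius, so that c3 is
    monotone over a window of width 4 k around the middle of a rotation; the
    distance 2 e between two points then translates into a phase error of at
    most k, and steps of length h hit each window of width k. *)
Definition small_parameters (k e h : R) : Prop :=
  [/\ 0 < k, k <= min_radius p / 8, 0 < e, 6 * e <= min_radius p ^+ 2 * sin k & 0 < h <= k].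

Context (k e h : R).
Hypothesis hs : small_parameters k e h.

Lemma min_radius_le : min_radius p <= 1/2.
Proof. by rewrite /min_radius; have := max_height_ge hp; lra. Qed.

Lemma sin_tolerance_le : sin k <= k.
Proof. by case: hs => k0 _ _ _ _; exact/sin_le_id/ltW. Qed.

Lemma noise_level_small : 6 * e < min_radius p ^+ 2 /\ 16 * e <= min_radius p.
Proof.
case: hs => k0 kr e0 ek /andP[h0 hk].
have := sin_tolerance_le; have := min_radius_le; have := min_radius_gt0 hp => r1 r2 s1.
have q0 : 0 < min_radius p ^+ 2 by rewrite exprn_gt0.
have q1 : min_radius p ^+ 2 <= min_radius p / 2 by nra.
have q2 : min_radius p ^+ 2 * sin k <= min_radius p ^+ 2 * (1 / 16).
  by rewrite ler_wpM2l ?(ltW q0)//; lra.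
by split; lra.
Qed.

(** Only rotating points satisfy |c1| > 1, and the sign of c1 tells the lobe;
    on one lobe, (c1, c3) determine the phase through [polar_angle]. *)
Lemma match_phase a b t t' : cross_section a -> cross_section b -> c1 a != 0 ->
  pi / 2 <= t - tau a <= pi / 2 + k -> (c1 b != 0 -> t' <= return_time p b) ->
  `|path_from p a t - path_from p b t'| <= 2 * e ->
  [/\ c1 b != 0, Num.sg (c1 b) = Num.sg (c1 a) &
      `|(t' - tau b) - (t - tau a)| <= k].
Proof.
case: hs => k0 kr e0 ek /andP[h0 hk].
move=> ca cb a0 /andP[f1 f2] tb /pt_norm_le[H1 _ H3].
have pi2 := pi_ge2 R; have rr := min_radius_gt0 hp; have rle := min_radius_le.
have [e1 e2] := noise_level_small.
have ta : tau a <= t by lra.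
have fr : 0 <= t - tau a <= rot_end R by rewrite /rot_end; apply/andP; split; lra.
have wa : 0 <= sheet_height p a <= max_height p by rewrite sheet_height_ge0 sheet_height_le.
have /andP[ra1 ra2] := lobe_radius_bounds hp wa fr.
have sf : 1/2 <= sin (t - tau a).
  by apply: sin_ge_half; rewrite ger0_norm; lra.
move: H1 H3; rewrite (path_rot hp ca a0 ta).
set f := t - tau a in f1 f2 fr ra1 ra2 sf *; set r := lobe_radius _ _ _ in ra1 ra2 *.
have A1 : min_radius p / 2 <= r * sin f by exact: mulr_ge_half.
set q := path_from p b t'.
rewrite c1B c3B c1E c3E => H1 H3.
have sgn_a : Num.sg (c1 a) = 1 \/ Num.sg (c1 a) = -1 by exact: sgP.
have q1 : 1 < Num.sg (c1 a) * c1 q.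
  move: H1; rewrite ler_norml => /andP[]; case: sgn_a => ->; lra.
have b0 : c1 b != 0.
  apply/negP => /eqP b0; move: q1.
  rewrite /q /path_from b0 eqxx/= /lin_flow {2}/c1/= -/(c1 b) b0 mul0r mulr0; lra.
have tb' : tau b < t'.
  rewrite ltNge; apply/negP => tb'; move: q1.
  rewrite /q /path_from tb' orbT; have := lin_c1_le1 b0 tb'.
  by rewrite ler_norml => /andP[]; case: sgn_a => ->; lra.
have {}tb := tb b0.
move: H1 H3 q1; rewrite {}/q (path_rot hp cb b0 (ltW tb')).
rewrite !c1E c3E.
set f' := t' - tau b; set r' := lobe_radius _ _ _ => H1 H3 q1.
have fr' : 0 <= f' <= rot_end R.
  by move: tb; rewrite /return_time /f' => tb; apply/andP; split; lra.
have wb : 0 <= sheet_height p b <= max_height p by rewrite sheet_height_ge0 sheet_height_le.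
have /andP[rb1 rb2] : min_radius p <= r' <= 3/2 := lobe_radius_bounds hp wb fr'.
have sb1 := sin_geN1 f'.
have ss : Num.sg (c1 b) = Num.sg (c1 a).
  have A3 : - (3/2) <= r' * sin f' by apply: mulr_geN; rewrite // (le_trans (ltW rr)).
  by move: q1; case: sgn_a (sgP b0) => -> [] -> // q1; exfalso; lra.
rewrite b0 ss; split=> //.
move: H1; rewrite ss -mulrBr normrM normr_sg a0 mul1r => H1.
apply: (@polar_angle _ (min_radius p) e k r r'); rewrite ?ra1 ?rb1 //.
- by rewrite k0; lra.
- by rewrite f1.
- by rewrite -normrN opprB; move: H1; congr (`|_| <= _); ring.
- by move: H3; congr (`|_| <= _); ring.
Qed.

(** The time at which the path that leaves the section point a at time T has
    rotated by pi/2. *)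
Definition mid_time T a : R := T + tau a + pi / 2.

Definition obs_index M : nat := `|Num.ceil (M / h)|%N.

Lemma obs_indexP M : 0 <= M -> M <= (obs_index M)%:R * h < M + h.
Proof.
case: hs => k0 kr e0 ek /andP[h0 hk].
move=> M0; rewrite /obs_index.
have c0 : (0 <= Num.ceil (M / h))%R.
  by rewrite ceil_ge0 (@lt_le_trans _ _ 0)// ?divr_ge0// ltW.
rewrite natr_absz ger0_norm//.
have := ceil_itv (M / h); rewrite intrD.
move=> /andP[g1 g2]; rewrite -ler_pdivrMr// g2/=.
rewrite -ltr_pdivlMr// mulrDl divff ?gt_eqF//; lra.
Qed.

Definition close_at a b T T' t : Prop :=
  `|flow_from p (t - T) a - flow_from p (t - T') b| <= 2 * e.

(** The observation in question takes place when the path of a is near the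
    middle of its rotation. By the bound on the return time of b, the other point has
    not yet returned to the section. *)
Lemma match_at a b T T' : cross_section a -> cross_section b -> c1 a != 0 ->
  0 <= mid_time T a -> (c1 b != 0 -> mid_time T a + h <= T' + return_time p b) ->
  close_at a b T T' ((obs_index (mid_time T a))%:R * h) ->
  [/\ c1 b != 0, Num.sg (c1 b) = Num.sg (c1 a) & `|mid_time T' b - mid_time T a| <= k].
Proof.
case: hs => k0 kr e0 ek /andP[h0 hk].
move=> ca cb a0 M0 tb; have := obs_indexP M0.
set t := _ * h => /andP[t1 t2].
have pi2 := pi_ge2 R; have rle := min_radius_le.
have mE : mid_time T a = T + tau a + pi / 2 by [].
rewrite /close_at !flow_from_path_le//; first 1 last.
- by move/tb => ?; lra.
- by move=> _; rewrite /return_time /rot_end; lra.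
move=> H; have [||b1 b2 b3] := match_phase ca cb a0 _ _ H.
- by apply/andP; split; lra.
- by move/tb => ?; lra.
- split=> //; move: b3; rewrite -normrN; congr (`|_| <= _); rewrite /mid_time; ring.
Qed.

Lemma close_atC a b T T' t : close_at a b T T' t -> close_at b a T' T t.
Proof. by rewrite /close_at distrC. Qed.

Lemma mid_time_return T a : mid_time T a + pi = T + return_time p a.
Proof. by rewrite /mid_time /return_time /rot_end; lra. Qed.

(** Two matched rotations end within k of each other, so both paths are
    already past the section when the next rotation is observed. *)
Lemma match_step a b T T' : cross_section a -> cross_section b ->
  c1 a != 0 -> c1 b != 0 -> 0 <= mid_time T a -> `|mid_time T' b - mid_time T a| <= k ->
  let a' := return_map p a in let b' := return_map p b in
  let T1 := T + return_time p a in let T1' := T' + return_time p b in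
  c1 a' != 0 ->
  (forall i : nat, mid_time T a <= i%:R * h -> i%:R * h <= mid_time T1 a' + h ->
     close_at a b T T' (i%:R * h)) ->
  [/\ c1 b' != 0, Num.sg (c1 b') = Num.sg (c1 a') & `|mid_time T1' b' - mid_time T1 a'| <= k].
Proof.
case: hs => k0 kr e0 ek /andP[h0 hk].
move=> ca cb a0 b0 M0; rewrite ler_norml => /andP[D1 D2] a' b' T1 T1' a'0 H.
have pi2 := pi_ge2 R; have rle := min_radius_le.
have ca' : cross_section a' := cross_section_return_map hp ca a0.
have cb' : cross_section b' := cross_section_return_map hp cb b0.
have E1 := mid_time_return T a; have E1' := mid_time_return T' b.
have t0 := tau_ge0 hp ca'; have t0' := tau_ge0 hp cb'.
have close_ret t : T1 <= t -> T1' <= t -> close_at a b T T' t -> close_at a' b' T1 T1' t.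
  move=> tT tT'; rewrite /close_at (flow_from_return hp ca a0); last by rewrite /T1 in tT; lra.
  rewrite (flow_from_return hp cb b0); last by rewrite /T1' in tT'; lra.
  by rewrite /T1 /T1' !opprD !addrA.
have M1 : mid_time T1 a' = T1 + tau a' + pi/2 by [].
have M1' : mid_time T1' b' = T1' + tau b' + pi/2 by [].
rewrite -/T1 in E1; rewrite -/T1' in E1'.
clearbody a' b' T1 T1'.
(* The path that is first to reach the middle of its next rotation is the one
   observed; the other is then still before the end of its next path. *)
have [cmp|] := boolP ((c1 b' == 0) || (mid_time T1 a' <= mid_time T1' b')).
  have M10 : 0 <= mid_time T1 a' by lra.
  have /andP[i1 i2] := obs_indexP M10.
  apply: match_at => //.
    by move/negbTE => z; rewrite z/= in cmp; have := mid_time_return T1' b'; lra.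
  apply: close_ret; [lra|lra|apply: H; lra].
rewrite negb_or -ltNge => /andP[b'0 cmp].
have M10 : 0 <= mid_time T1' b' by lra.
have /andP[i1 i2] := obs_indexP M10.
have [|||?? ?] := @match_at b' a' T1' T1 cb' ca' b'0.
- by [].
- by move=> _; have := mid_time_return T1 a'; lra.
- apply: close_atC; apply: close_ret; [lra|lra|apply: H; lra].
by split=> //; rewrite distrC.
Qed.
End Matching.

(** * Orbits of the section and surviving starts *)

(** In a difference r cos s - r' cos s', the variation of the cosine dominates
    that of the radius when the cosine itself is small. *)
Lemma product_rule_lower_bound (R : realType) (m r d dc q c : R) : 0 < m -> m <= r -> 0 <= d ->
  1/2 * d <= dc -> `|q| <= 1/2 -> `|c| <= m / 4 ->
  m / 4 * d <= r * dc - (q * d) * c.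
Proof.
move=> m0 mr d0 dcd q1 c1.
have h1 : m * (1/2 * d) <= r * dc by rewrite ler_pM//; lra.
have : `|q * d * c| <= 1/2 * d * (m / 4).
  by rewrite normrM ler_pM// normrM (ger0_norm d0) ler_wpM2r.
rewrite ler_norml => /andP[_ h2].
have : 0 <= m * d by rewrite mulr_ge0 // ltW.
lra.
Qed.

Section Orbits.
Context (R : realType) (p : lorenz_params R).
Hypothesis hp : admissible p.
Local Notation tau := (tau_Sigma p).
Implicit Types (a b u v : pt R) (s t w x T : R).

Definition nth_section a n : pt R := iter n (return_map p) a.

Fixpoint hit_time T a n : R :=
  if n is m.+1 then hit_time T a m + return_time p (nth_section a m) else T.

Lemma cross_section_nth a n : cross_section a ->
  (forall j, (j < n)%N -> c1 (nth_section a j) != 0) -> cross_section (nth_section a n).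
Proof.
move=> ca; elim: n => // n IH H; apply: cross_section_return_map => //; last exact: H.
by apply: IH => j jn; apply: H; exact: ltnW.
Qed.

(** After the n-th return the flow may be computed from the n-th section point
    instead of the initial one. *)
Lemma flow_from_nth_section a n T t : cross_section a ->
  (forall j, (j < n)%N -> c1 (nth_section a j) != 0) -> hit_time T a n <= t ->
  flow_from p (t - T) a = flow_from p (t - hit_time T a n) (nth_section a n).
Proof.
move=> ca; elim: n => // n IH H /= ht.
have H' j : (j < n)%N -> c1 (nth_section a j) != 0 by move=> jn; apply: H; exact: ltnW.
have cn := cross_section_nth ca H'.
have r3 := return_time_ge hp cn.
rewrite IH//; last by lra.
rewrite (flow_from_return hp cn) ?H//; last by lra.
by congr (flow_from p _ _); ring.
Qed.

(** On points of equal sign the first coordinate of the return map is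
    theta |x|^alpha up to sign and translation. *)
Lemma return_map_expanding a b : cross_section a -> cross_section b ->
  c1 a != 0 -> c1 b != 0 -> Num.sg (c1 b) = Num.sg (c1 a) ->
  expansion p * `|c1 b - c1 a| <= `|c1 (return_map p b) - c1 (return_map p a)|.
Proof.
move=> ca cb a0 b0 ss.
rewrite !return_mapE// !c1E ss -mulrBr normrM normr_sg a0 mul1r.
rewrite (_ : _ - _ - _ = theta p * (sheet_height p b - sheet_height p a)); last by ring.
rewrite {1}[c1 b]numEsg {1}[c1 a]numEsg ss -mulrBr normrM normr_sg a0 mul1r.
have [a1 _ _] := ca; have [b1 _ _] := cb.
have key x y : 0 < x -> 0 < y -> x <= 1/2 -> y <= 1/2 ->
    expansion p * `|y - x| <= `|theta p * (y `^ alpha p - x `^ alpha p)|.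
  wlog xy : x y / x <= y.
    move=> W x0 y0 x1 y1; have [xy|/ltW yx] := leP x y; first exact: W.
    have := W _ _ yx y0 x0 y1 x1.
    by rewrite distrC -[X in _ <= X]normrN -mulrN opprB.
  move=> x0 y0 x1 y1; move: xy; rewrite le_eqVlt => /predU1P[->|xy].
    by rewrite !subrr normr0 mulr0.
  rewrite (ger0_norm (x := y - x)) ?subr_ge0 ?(ltW xy)//.
  by apply: le_trans (powR_diff hp x0 xy y1) _; exact: ler_norm.
by rewrite mul1r; apply: key; rewrite ?normr_gt0.
Qed.

(** Powers of a number greater than 1 are unbounded, by Bernoulli's
    inequality. *)
Lemma expansion_pow (r : R) : 0 < r -> exists m, 1 <= r * expansion p ^+ m.
Proof.
move=> r0; have L1 := expansion_gt1 hp.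
have [m Hm] : exists m : nat, r^-1 <= m%:R * (expansion p - 1).
  exists (Num.bound (r^-1 / (expansion p - 1))).
  rewrite -ler_pdivrMr ?subr_gt0//; apply/ltW/archi_boundP.
  by rewrite divr_ge0 ?invr_ge0 ?(ltW r0)// subr_ge0 ltW.
exists m; rewrite mulrC -ler_pdivrMr// div1r; apply: le_trans Hm _.
elim: m => [|m IH]; first by rewrite mul0r expr0.
rewrite exprS -natr1.
have : 1 <= expansion p ^+ m by rewrite exprn_ege1// ltW.
nra.
Qed.

(** The derivative of r(s) cos s is r' cos s - r sin s, and near s = pi/2
    the second term dominates. *)
Lemma rot_monotone (k w s s' : R) : 0 < k -> k <= min_radius p / 8 -> 0 <= w <= max_height p ->
  pi / 2 - 2 * k <= s -> s <= s' -> s' <= pi / 2 + 2 * k ->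
  min_radius p / 4 * (s' - s) <=
  lobe_radius p w s * cos s - lobe_radius p w s' * cos s'.
Proof.
move=> k0 kr w01 s1 ss s2.
have pi2 := pi_ge2 R.
have rr := min_radius_gt0 hp; have rle := min_radius_le hp.
have srot : 0 <= s <= rot_end R by rewrite /rot_end; apply/andP; split; lra.
have /andP[ra1 _] := lobe_radius_bounds hp w01 srot.
have [q q1 qE] := lobe_radius_diffs hp s s' w01.
have := ss; rewrite le_eqVlt => /predU1P[->|lt]; first by rewrite !subrr mulr0.
have [c cI cE] := cos_diff lt.
have dc : 1/2 * (s' - s) <= cos s - cos s'.
  rewrite cE ler_wpM2r ?subr_ge0//; apply: sin_ge_half.
  by move: cI; rewrite in_itv/= => /andP[c1 c2]; rewrite ler_norml; lra.
have cs : `|cos s'| <= min_radius p / 4.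
  rewrite -normrN -sinBpihalf; apply: le_trans (norm_sin_le _) _.
  by rewrite ler_norml; lra.
have d0 : 0 <= s' - s by rewrite subr_ge0.
have := product_rule_lower_bound rr ra1 d0 dc q1 cs; rewrite -qE => H.
by apply: le_trans H _; rewrite le_eqVlt; apply/orP; left; apply/eqP; ring.
Qed.

Section Survivors.
Context (k e h : R).
Hypothesis hs : small_parameters p k e h.
Context (a : pt R) (T : R) (Z : nat -> pt R).
Hypothesis ca : cross_section a.
Hypothesis ga : forall n, c1 (nth_section a n) != 0.
Hypothesis M0 : 0 <= mid_time p T a.

Definition nth_mid b S n : R := mid_time p (hit_time S b n) (nth_section b n).

Lemma nth_midS b S n :
  nth_mid b S n.+1 = nth_mid b S n + pi + tau (nth_section b n.+1) + pi / 2.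
Proof. by rewrite /nth_mid mid_time_return. Qed.

Hypothesis Ze : forall i, `|Z i| <= e.

(** The start (b, S) is a section point b together with the time S at
    which it is met. It is matched with the start (a, T) of the true path on the
    first rotation, and consistent with the observations up to index K that are
    made after the middle of that rotation. *)
Definition survives K b S : Prop :=
  [/\ cross_section b, c1 b != 0, Num.sg (c1 b) = Num.sg (c1 a),
     `|mid_time p S b - mid_time p T a| <= k
   & forall i, (i <= K)%N -> mid_time p T a <= i%:R * h ->
       `|flow_from p (i%:R * h - T) a + Z i - flow_from p (i%:R * h - S) b| <= e].

(** Convergence in K that is uniform over the survivors: since survivors
    only become fewer, one K suffices. These properties form a filter,
    [survivors]. *)
Definition eventually_all (Q : pt R -> R -> Prop) : Prop :=
  exists K, forall b S, survives K b S -> Q b S.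

Lemma survivesW K K' b S : (K <= K')%N -> survives K' b S -> survives K b S.
Proof.
by move=> KK [h1 h2 h3 h4 h5]; split=> // i iK; apply: h5; exact: leq_trans KK.
Qed.

Lemma evS (Q Q' : pt R -> R -> Prop) : (forall b S, Q b S -> Q' b S) ->
  eventually_all Q -> eventually_all Q'.
Proof. by move=> H [K HK]; exists K => b S /HK/H. Qed.

Lemma evI (Q Q' : pt R -> R -> Prop) : eventually_all Q -> eventually_all Q' ->
  eventually_all (fun b S => Q b S /\ Q' b S).
Proof.
move=> [K HK] [K' HK']; exists (maxn K K') => b S H; split.
  by apply: HK; apply: survivesW H; exact: leq_maxl.
by apply: HK'; apply: survivesW H; exact: leq_maxr.
Qed.

Lemma ev_survives K : eventually_all (survives K).
Proof. by exists K. Qed.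

Lemma cross_section_orbit n : cross_section (nth_section a n).
Proof. by apply: cross_section_nth => // j _. Qed.

Lemma nth_mid_mono n : nth_mid a T n + pi <= nth_mid a T n.+1.
Proof.
by rewrite nth_midS; have := tau_ge0 hp (cross_section_orbit n.+1); have := pi_ge2 R; lra.
Qed.

Lemma nth_mid_ge n : mid_time p T a <= nth_mid a T n.
Proof.
elim: n => [|n IH]; first exact: lexx.
by apply: le_trans IH _; have := nth_mid_mono n; have := pi_ge2 R; lra.
Qed.

Definition same_itinerary n b S : Prop := cross_section b /\
  forall j, (j <= n)%N -> [/\ c1 (nth_section b j) != 0, Num.sg (c1 (nth_section b j)) = Num.sg (c1 (nth_section a j))
    & `|nth_mid b S j - nth_mid a T j| <= k].

Lemma same_itinerary_sec n b S j : same_itinerary n b S -> (j <= n.+1)%N ->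
  cross_section (nth_section b j).
Proof.
move=> [cb H] jn; apply: cross_section_nth => // i ij.
by have [] := H i (leq_trans ij jn).
Qed.

Lemma same_itinerary_hit n b S j : same_itinerary n b S -> (j <= n)%N ->
  hit_time S b j <= nth_mid a T j.
Proof.
move=> H jn; have cj := same_itinerary_sec H (leqW jn).
have := tau_ge0 hp cj; have := pi_ge2 R.
case: H => _ /(_ j jn)[_ _]; rewrite ler_norml => /andP[_].
case: hs => k0 kr _ _ _; have := min_radius_le hp.
rewrite {1}/nth_mid {1}/mid_time; lra.
Qed.

Lemma hit_time_le_mid n : hit_time T a n <= nth_mid a T n.
Proof.
rewrite /nth_mid /mid_time; have := tau_ge0 hp (cross_section_orbit n); have := pi_ge2 R; lra.
Qed.

(** The constraint of an observation, expressed with the n-th section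
    points of both paths. *)
Lemma survivor_dist n b S K i : survives K b S -> same_itinerary n b S ->
  (i <= K)%N -> nth_mid a T n <= i%:R * h ->
  `|flow_from p (i%:R * h - hit_time T a n) (nth_section a n) + Z i
    - flow_from p (i%:R * h - hit_time S b n) (nth_section b n)| <= e.
Proof.
move=> [cb b0 ss mm H] sI iK ni.
rewrite -!flow_from_nth_section//.
- by apply: H => //; apply: le_trans ni; exact: nth_mid_ge.
- by move=> j jn; have [_ /(_ j (ltnW jn))[]] := sI.
- by apply: le_trans ni; exact: same_itinerary_hit sI (leqnn _).
- by apply: le_trans ni; exact: hit_time_le_mid.
Qed.

Lemma archi_obs (x : R) : exists K : nat, x <= K%:R * h.
Proof.
case: hs => _ _ _ _ /andP[h0 _].
exists (Num.bound (Num.max 0 x / h)).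
rewrite -ler_pdivrMr//.
apply: (@le_trans _ _ (Num.max 0 x / h)).
  by rewrite ler_pM2r ?invr_gt0// le_max lexx orbT.
by apply/ltW/archi_boundP; rewrite divr_ge0// ?le_max ?lexx// ltW.
Qed.

(** Induction on n by [match_step]; a survivor of the observations up to the
    middle of rotation n + 1 of the true path is matched on that rotation. *)
Lemma ev_itinerary n : eventually_all (same_itinerary n).
Proof.
elim: n => [|n IH].
  exists 0%N => b S [cb b0 ss mm _]; split=> // j.
  by rewrite leqn0 => /eqP->.
have [K0 HK0] := archi_obs (nth_mid a T n.+1 + h).
apply: evS (evI IH (ev_survives K0)) => b S [sI sv].
have [cb Hb] := sI; split=> // j.
rewrite leq_eqVlt => /predU1P[->|]; last by rewrite ltnS; exact: Hb.
have [bn sn mn] := Hb n (leqnn n).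
have cbn := same_itinerary_sec sI (leqnSn n).
apply: (match_step hp hs (cross_section_orbit n) cbn (ga n) bn) => //.
- by apply: le_trans M0 _; exact: nth_mid_ge.
- exact: (ga n.+1).
move=> i i1 i2; rewrite /close_at.
have h0 : 0 < h by case: hs => _ _ _ _ /andP[].
have iK : (i <= K0)%N.
  by rewrite -(ler_nat R) -(ler_pM2r h0) (le_trans i2).
have := survivor_dist sv sI iK i1.
move: (flow_from _ _ _) (flow_from _ _ _) => v u H.
rewrite (_ : u - v = (u + Z i - v) - Z i); last by rewrite addrAC addrK.
by apply: le_trans (ler_normB _ _) _; have := Ze i; lra.
Qed.

(** The distance of the section points n + m is at most 1 and at least the
    m-th power of the expansion factor times the distance of the section
    points n. *)
Lemma ev_close n r : 0 < r ->
  eventually_all (fun b S => `|c1 (nth_section b n) - c1 (nth_section a n)| <= r).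
Proof.
move=> rp; have [m Hm] := expansion_pow rp.
apply: evS (ev_itinerary (n + m)) => b S sI.
have L1 := expansion_gt1 hp.
have key j : (j <= m)%N -> expansion p ^+ j * `|c1 (nth_section b n) - c1 (nth_section a n)| <=
    `|c1 (nth_section b (n + j)) - c1 (nth_section a (n + j))|.
  elim: j => [|j IH] jm; first by rewrite expr0 mul1r addn0.
  have jm' : (n + j <= n + m)%N by rewrite leq_add2l ltnW.
  have [_ /(_ _ jm')[b0 ss _]] := sI.
  have := return_map_expanding (cross_section_orbit _) (same_itinerary_sec sI (leqW jm')) (ga _) b0 ss.
  rewrite addnS exprS -mulrA; apply: le_trans.
  by rewrite ler_pM2l ?IH// 1?ltnW//; lra.
have := key m (leqnn m).
have [a1 _ _] := cross_section_orbit (n + m); have [b1 _ _] := same_itinerary_sec sI (leqnSn _).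
have le1 : `|c1 (nth_section b (n + m)) - c1 (nth_section a (n + m))| <= 1.
  by apply: le_trans (ler_normB _ _) _; lra.
have Lm : 0 < expansion p ^+ m by rewrite exprn_gt0//; lra.
move=> /le_trans/(_ le1) H.
by rewrite -(ler_pM2l Lm); apply: le_trans H _; rewrite mulrC.
Qed.

Lemma ev_continuous (g : R -> R) n r : 0 < r -> {for c1 (nth_section a n), continuous g} ->
  eventually_all (fun b S => `|g (c1 (nth_section b n)) - g (c1 (nth_section a n))| <= r).
Proof.
move=> rp /cvgrPdist_le/(_ _ rp) /nbhs_ballP[d/= d0 H].
apply: evS (ev_close n (_ : 0 < d / 2)); last by rewrite divr_gt0.
move=> b S le; rewrite distrC; apply: H; rewrite /ball/= distrC.
by apply: le_lt_trans le _; rewrite ltr_pdivrMr// ltr_pMr// ltr1n.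
Qed.

Lemma continuous_tau x : x != 0 ->
  {for x, continuous (fun y : R => (lam1 p)^-1 * ln (1 / `|y|))}.
Proof.
move=> x0; apply: cvgM; first exact: cvg_cst.
apply: (@continuous_comp _ _ _ (fun y : R => 1 / `|y|) (@ln R)).
  apply: cvgM; first exact: cvg_cst.
  by apply: cvgV; [rewrite normr_eq0|exact: norm_continuous].
by apply: continuous_ln; rewrite divr_gt0// normr_gt0.
Qed.

Lemma continuous_height x : x != 0 ->
  {for x, continuous (fun y : R => `|y| `^ alpha p)}.
Proof.
move=> x0.
apply: (@continuous_comp _ _ _ (fun y : R => `|y|) (fun y => y `^ alpha p)).
  exact: norm_continuous.
apply: differentiable_continuous; apply/derivable1_diffP.
by apply: derivable_powR; rewrite in_itv/= andbT normr_gt0.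
Qed.

Lemma ev_tau n r : 0 < r ->
  eventually_all (fun b S => `|tau (nth_section b n) - tau (nth_section a n)| <= r).
Proof. by move=> rp; exact: (ev_continuous rp (continuous_tau (ga n))). Qed.

Lemma ev_height n r : 0 < r -> eventually_all
  (fun b S => `|sheet_height p (nth_section b n) - sheet_height p (nth_section a n)| <= r).
Proof. by move=> rp; exact: (ev_continuous rp (continuous_height (ga n))). Qed.

(** The delay of the survivor at rotation n. *)
Definition time_shift b S n : R := nth_mid b S n - nth_mid a T n.

(** The delays at rotations n and n + 1 differ by the difference of the
    linear phase durations, which tends to 0 because tau is continuous away from
    c1 = 0. *)
Lemma ev_time_shift n r : 0 < r ->
  eventually_all (fun b S => `|time_shift b S n - time_shift b S 0| <= r).
Proof.
elim: n r => [|n IH] r rp.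
  by exists 0%N => b S _; rewrite subrr normr0 ltW.
have r2 : 0 < r / 2 by rewrite divr_gt0.
apply: evS (evI (IH _ r2) (ev_tau n.+1 r2)) => b S [H1 H2].
have -> : time_shift b S n.+1 - time_shift b S 0 =
    (time_shift b S n - time_shift b S 0) + (tau (nth_section b n.+1) - tau (nth_section a n.+1)).
  by rewrite /time_shift !nth_midS; ring.
by apply: le_trans (ler_normD _ _) _; lra.
Qed.
End Survivors.
End Orbits.

(** * Elimination of time shifts by the noise *)

Section Shift.
Context (R : realType) (p : lorenz_params R).
Hypothesis hp : admissible p.
Local Notation tau := (tau_Sigma p).
Implicit Types (b u v : pt R) (s t w x S : R).
Context (k e h : R).
Hypothesis hs : small_parameters p k e h.
Context (a : pt R) (T : R) (Z : nat -> pt R).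
Hypothesis ca : cross_section a.
Hypothesis ga : forall n, c1 (nth_section p a n) != 0.
Hypothesis M0 : 0 <= mid_time p T a.
Hypothesis Ze : forall i, `|Z i| <= e.

Definition mid_obs n : nat := obs_index h (nth_mid p a T n).

Hypothesis noise_top :
  forall d : R, 0 < d -> exists n, e - d < c3 (Z (mid_obs n)).
Hypothesis noise_bot :
  forall d : R, 0 < d -> exists n, c3 (Z (mid_obs n)) < - e + d.

Local Notation eventually_all := (eventually_all p k e h a T Z).
Local Notation survives := (survives p k e h a T Z).
Local Notation time_shift := (time_shift p a T).
Local Notation third w f := (lobe_radius p w f * cos f).

Lemma third_diff w w' f : 0 <= f <= rot_end R ->
  `|third w' f - third w f| <= 2 * `|w' - w|.
Proof.
move=> fr; rewrite -mulrBl normrM.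
apply: le_trans (lobe_radius_diffw hp w w' fr).
by rewrite ler_piMr// cos_max.
Qed.

Definition mid_phase n : R :=
  (mid_obs n)%:R * h - hit_time p T a n - tau (nth_section p a n).

Lemma nth_mid_ge0 n : 0 <= nth_mid p a T n.
Proof. by apply: le_trans M0 _; exact: nth_mid_ge. Qed.

Lemma mid_phaseP n : pi / 2 <= mid_phase n <= pi / 2 + k.
Proof.
have hs' := hs; case: hs' => k0 kr e0 ek /andP[h0 hk].
have /andP[i1 i2] := obs_indexP hs (nth_mid_ge0 n).
rewrite /mid_phase /mid_obs; move: i1 i2; set t := _ * h.
rewrite /nth_mid /mid_time; set H := hit_time _ _ _ _; set ta := tau _.
by move=> i1 i2; apply/andP; split; lra.
Qed.

(** The third coordinate of the constraint at the middle of rotation n: the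
    true angle is [mid_phase n] and that of the survivor lags behind by the time
    shift. *)
Lemma survivor_third n b S : survives (mid_obs n) b S ->
  same_itinerary p k a T n b S ->
  `|c3 (Z (mid_obs n)) + (third (sheet_height p (nth_section p b n)) (mid_phase n - time_shift b S n)
    - third (sheet_height p (nth_section p a n)) (mid_phase n))| <= e.
Proof.
move=> sv sI; have can := cross_section_orbit hp ca ga n; have cbn := same_itinerary_sec hp sI (leqnSn n).
have /andP[i1 i2] := obs_indexP hs (nth_mid_ge0 n).
have := survivor_dist hp hs ca ga sv sI (leqnn _) i1.
have [cb /(_ n (leqnn n))[b0 ss]] := sI; rewrite ler_norml => /andP[D1 D2].
have hs' := hs; case: hs' => k0 kr e0 ek /andP[h0 hk].
have rle := min_radius_le hp; have pi2 := pi_ge2 R.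
have /andP[f1 f2] := mid_phaseP n.
have fE : (mid_obs n)%:R * h - hit_time p T a n = tau (nth_section p a n) + mid_phase n.
  by rewrite /mid_phase; ring.
have fE' : (mid_obs n)%:R * h - hit_time p S b n =
    tau (nth_section p b n) + (mid_phase n - time_shift b S n).
  by rewrite /time_shift /nth_mid /mid_time /mid_phase; ring.
move: D1 D2; rewrite -/(time_shift b S n); move: (time_shift b S n) fE' => D fE' D1 D2.
rewrite -/(mid_obs n) fE fE'; move: (mid_phase n) f1 f2 => f f1 f2 {fE fE'}.
have rE x : x <= pi / 2 + 1/2 -> forall y : R, y + x <= y + rot_end R.
  by move=> xl y; rewrite lerD2l /rot_end; lra.
rewrite !flow_from_path_le//; first last.
- by move=> _; rewrite /return_time; apply: rE; lra.
- by move=> _; rewrite /return_time; apply: rE; lra.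
rewrite !path_rot//; try lra.
rewrite !(addrAC (tau _) _ (- tau _)) !subrr !add0r.
move=> /pt_norm_le[_ _]; congr (`|_| <= e).
rewrite c3B /c3/=; ring.
Qed.

(** A time shift changes c3 near the middle of a rotation at a rate of at least
    a quarter of the radius. The error of d/16 times the radius comes from the difference
    of heights, the error d/4 from the variation of the shift between rotations. *)
Lemma ev_time_shift_near d n : 0 < d -> eventually_all (fun b S =>
  [/\ `|time_shift b S n - time_shift b S 0| <= d / 4, `|time_shift b S n| <= k &
   exists2 x, `|c3 (Z (mid_obs n)) + x| <= e &
    (0 <= time_shift b S n ->
      min_radius p / 4 * time_shift b S n - min_radius p * d / 16 <= x) /\
    (time_shift b S n <= 0 ->
      x <= min_radius p / 4 * time_shift b S n + min_radius p * d / 16)]).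
Proof.
move=> d0; have rr := min_radius_gt0 hp.
have d4 : 0 < d / 4 by rewrite divr_gt0.
have rd32 : 0 < min_radius p * d / 32 by rewrite divr_gt0// mulr_gt0.
have E := evI (evI (ev_time_shift hp hs ca ga M0 Ze n d4) (ev_height hp hs ca ga M0 Ze n rd32))
  (evI (ev_itinerary hp hs ca ga M0 Ze n) (ev_survives p k e h a T Z (mid_obs n))).
apply: evS E => b S [[H1 H2] [sI sv]].
have Z3 := survivor_third sv sI.
have wa : 0 <= sheet_height p (nth_section p a n) <= max_height p.
  by rewrite sheet_height_ge0 sheet_height_le//; exact: cross_section_orbit.
have [cb /(_ n (leqnn n))[b0 ss D12]] := sI.
split=> //; exists (third (sheet_height p (nth_section p b n)) (mid_phase n - time_shift b S n)
    - third (sheet_height p (nth_section p a n)) (mid_phase n)) => //.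
move: D12; rewrite -/(time_shift b S n) ler_norml => /andP[D1 D2].
have /andP[f1 f2] := mid_phaseP n.
have hs' := hs; case: hs' => k0 kr e0 ek /andP[h0 hk].
have rle := min_radius_le hp; have pi2 := pi_ge2 R.
move: D1 D2 {H1 Z3}; move: (time_shift b S n) => D D1 D2.
move: H2 wa; move: (sheet_height p _) (sheet_height p _) => w w' H2 wa.
move: (mid_phase n) f1 f2 => f f1 f2.
have g1 : 0 <= f - D <= rot_end R by rewrite /rot_end; apply/andP; split; lra.
have := third_diff w w' g1; rewrite distrC in H2.
rewrite ler_norml => /andP[g2 g3].
have H3 : `|w' - w| <= min_radius p * d / 32 by rewrite distrC.
split=> D0.
  have g4 : min_radius p / 4 * (f - (f - D)) <= third w (f - D) - third w f.
    by apply: (rot_monotone hp k0 kr wa); lra.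
  lra.
have g4 : min_radius p / 4 * (f - D - f) <= third w f - third w (f - D).
  by apply: (rot_monotone hp k0 kr wa); lra.
lra.
Qed.

(** A shift of more than d makes c3 of the survivor too low at every
    mid-rotation observation, which contradicts the constraint at an observation
    whose noise is nearly e; similarly for shifts below - d and noise near - e. *)
Lemma ev_time_shift0 (d : R) : 0 < d ->
  eventually_all (fun b S => `|time_shift b S 0| <= d).
Proof.
move=> d0; have rr := min_radius_gt0 hp.
have rd0 : 0 < min_radius p * d by rewrite mulr_gt0.
have rd : 0 < min_radius p * d / 8 by rewrite divr_gt0.
have [n Hn] := noise_top rd; have [m Hm] := noise_bot rd.
apply: evS (evI (ev_time_shift_near n d0) (ev_time_shift_near m d0)) => b S.
move=> [[A1 _ [x x1 [x2 _]]] [B1 _ [y y1 [_ y2]]]].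
move: A1 B1 x1 y1; rewrite !ler_norml => /andP[A1 A2] /andP[B1 B2] /andP[_ x1] /andP[y1 _].
apply/andP; split; rewrite leNgt; apply/negP => S0.
  have g : min_radius p * time_shift b S m <= min_radius p * (- (3 / 4 * d)).
    by rewrite ler_pM2l//; lra.
  by have := y2 (_ : _ <= 0); lra.
have g : min_radius p * (3 / 4 * d) <= min_radius p * time_shift b S n.
  by rewrite ler_pM2l//; lra.
by have := x2 (_ : 0 <= _); lra.
Qed.

(** The middle of a rotation is reached at a fixed time after the end of the
    linear phase, so the shift of the starts differs from that of the first
    rotations by a difference of linear phase durations. *)
Lemma ev_start (d : R) : 0 < d -> eventually_all (fun b S => `|S - T| <= d).
Proof.
move=> d0; have d2 : 0 < d / 2 by rewrite divr_gt0.
apply: evS (evI (ev_time_shift0 d2) (ev_tau hp hs ca ga M0 Ze 0 d2)) => b S [H1 H2].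
rewrite (_ : S - T = time_shift b S 0 - (tau (nth_section p b 0) - tau (nth_section p a 0))).
  by apply: le_trans (ler_normB _ _) _; lra.
by rewrite /time_shift /nth_mid /mid_time /=; ring.
Qed.
End Shift.

(** * Continuity of a path in its start *)

Section Continuity.
Context (R : realType) (p : lorenz_params R).
Hypothesis hp : admissible p.
Local Notation tau := (tau_Sigma p).
Context (X : Type) (F : set_system X) {FF : Filter F}.

Lemma lobe_cvg (W f : X -> R) w f0 : W x @[x --> F] --> w -> f x @[x --> F] --> f0 ->
  lobe_radius p (W x) (f x) @[x --> F] --> lobe_radius p w f0.
Proof.
move=> cW cf; rewrite /lobe_radius; apply: cvgD.
  by apply: cvgB => //; exact: cvg_cst.
apply: cvgM; last by apply: cvgM => //; exact: cvg_cst.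
apply: cvgB; first exact: cvg_cst.
by apply: cvgM => //; exact: cvg_cst.
Qed.

Lemma lobe_sin_cvg (W f : X -> R) w f0 : W x @[x --> F] --> w -> f x @[x --> F] --> f0 ->
  lobe_radius p (W x) (f x) * sin (f x) @[x --> F] --> lobe_radius p w f0 * sin f0.
Proof.
move=> cW cf; apply: cvgM; first exact: lobe_cvg.
by apply: continuous_cvg => //; exact: continuous_sin.
Qed.

Lemma lobe_cos_cvg (W f : X -> R) w f0 : W x @[x --> F] --> w -> f x @[x --> F] --> f0 ->
  lobe_radius p (W x) (f x) * cos (f x) @[x --> F] --> lobe_radius p w f0 * cos f0.
Proof.
move=> cW cf; apply: cvgM; first exact: lobe_cvg.
by apply: continuous_cvg => //; exact: continuous_cos.
Qed.

(** Away from the junction s = tau a, points near (a, s) are described by the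
    same formula as (a, s), and all terms of this formula are continuous. *)
Lemma path_cvg (B : X -> pt R) (S : X -> R) (a : pt R) (s : R) :
  cross_section a -> c1 a != 0 -> s != tau a ->
  (\forall x \near F, [/\ cross_section (B x), c1 (B x) != 0 &
     Num.sg (c1 (B x)) = Num.sg (c1 a)]) ->
  c1 (B x) @[x --> F] --> c1 a -> S x @[x --> F] --> s ->
  (c1 (path_from p (B x) (S x)) @[x --> F] --> c1 (path_from p a s)) /\
  (c3 (path_from p (B x) (S x)) @[x --> F] --> c3 (path_from p a s)).
Proof.
move=> ca a0 sa nB cB cS.
have ct : tau (B x) @[x --> F] --> tau a.
  exact: (@continuous_cvg _ _ _ F _ _ (fun y : R => (lam1 p)^-1 * ln (1 / `|y|)) _
    (continuous_tau a0) cB).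
have cw : sheet_height p (B x) @[x --> F] --> sheet_height p a.
  exact: (@continuous_cvg _ _ _ F _ _ (fun y : R => `|y| `^ alpha p) _
    (continuous_height a0) cB).
have cd : S x - tau (B x) @[x --> F] --> s - tau a by exact: cvgB.
have eqc (f g : X -> R) (l : R) : (\forall x \near F, f x = g x) ->
    f x @[x --> F] --> l -> g x @[x --> F] --> l.
  by move=> H; apply: cvg_trans; exact: near_eq_cvg.
have [st|st] : s < tau a \/ tau a < s.
- by move: sa; rewrite neq_lt => /orP[]; [left|right].
- have nst : \forall x \near F, S x - tau (B x) < 0.
    by apply: (cvgr_lt _ cd); rewrite subr_lt0.
  have cexp (l : R) : expR (l * S x) @[x --> F] --> expR (l * s).
    apply: (@continuous_cvg _ _ _ F _ _ expR); first exact: continuous_expR.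
    by apply: cvgM => //; exact: cvg_cst.
  have pE : \forall x \near F, path_from p (B x) (S x) = lin_flow p (S x) (B x).
    by apply: filterS nst => x; rewrite subr_lt0 /path_from => /ltW ->; rewrite orbT.
  have aE : path_from p a s = lin_flow p s a by rewrite /path_from (ltW st) orbT.
  split.
    apply: (eqc (fun x => c1 (B x) * expR (lam1 p * S x)) (fun x => c1 (path_from p (B x) (S x)))).
      by apply: filterS pE => x ->.
    by rewrite aE; exact: cvgM.
  apply: (eqc (fun x => c3 a * expR (- lam3 p * S x)) (fun x => c3 (path_from p (B x) (S x)))).
    apply: filterS (filterI pE nB) => x [-> [[_ _ b3] _ _]].
    by rewrite /lin_flow c3E b3; have [_ _ ->] := ca.
  by rewrite aE; apply: cvgM => //; exact: cvg_cst.
have nst : \forall x \near F, 0 < S x - tau (B x).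
  by apply: (cvgr_gt _ cd); rewrite subr_gt0.
rewrite (path_rot hp ca a0 (ltW st)) c1E c3E; split.
  apply: (eqc (fun x => Num.sg (c1 a) * (1 +
     lobe_radius p (sheet_height p (B x)) (S x - tau (B x)) * sin (S x - tau (B x))))
     (fun x => c1 (path_from p (B x) (S x)))).
    apply: filterS (filterI nst nB) => x [+ [cb b0 ss]].
    by rewrite subr_gt0 => /ltW ?; rewrite path_rot// c1E ss.
  apply: cvgM; first exact: cvg_cst.
  by apply: cvgD; [exact: cvg_cst|exact: lobe_sin_cvg].
apply: (eqc (fun x => 1 -
     lobe_radius p (sheet_height p (B x)) (S x - tau (B x)) * cos (S x - tau (B x)))
     (fun x => c3 (path_from p (B x) (S x)))).
  apply: filterS (filterI nst nB) => x [+ [cb b0 ss]].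
  by rewrite subr_gt0 => /ltW ?; rewrite path_rot// c3E.
by apply: cvgB; [exact: cvg_cst|exact: lobe_cos_cvg].
Qed.
End Continuity.

(** * Recovery of the initial point *)

(** Up to the angle pi, opposite lobes lie in c1 >= 1 and c1 <= -1. After
    pi, c2 has moved by at least 1/6 away from its value at the start of the
    rotation, which is at most m/2 < 1/6 in absolute value; the two lobes move in
    opposite directions. *)
Lemma opposite_lobes_apart (R : realType) (sg A B r r' f f' d e m : R) :
  `|sg| = 1 -> `|A| <= m / 2 -> `|B| <= m / 2 -> 0 <= r <= 3/2 -> 0 <= r' <= 3/2 ->
  pi / 2 <= f <= rot_end R -> 0 <= f' <= rot_end R -> `|f' - f| <= d ->
  4 * d <= 1/3 - m -> 16 * e <= 1/3 - m -> 0 <= m < 1/3 -> 0 < e ->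
  `|sg * (1 + r * sin f) - - sg * (1 + r' * sin f')| <= 2 * e ->
  `|A - sg / 4 * (f / rot_end R) - (B - - sg / 4 * (f' / rot_end R))| <= 2 * e ->
  False.
Proof.
move=> sgn A2 B2 /andP[r1 r2] /andP[r1' r2'] /andP[f1 f2] /andP[f1' f2'] dd d1 e1.
move=> /andP[m0 bl] e0; have pi2 := pi_ge2 R; have re0 := rot_end_gt0 R.
rewrite (_ : sg * _ - _ = sg * (2 + r * sin f + r' * sin f')); last by ring.
rewrite normrM sgn mul1r => H1.
rewrite (_ : _ - _ - _ = (A - B) - sg * ((f / rot_end R + f' / rot_end R) / 4));
  last by field; rewrite gt_eqF.
move=> H2.
move: dd; rewrite ler_norml => /andP[dd1 dd2].
have [fpi|fpi] := leP f pi.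
  have sf : 0 <= r * sin f.
    by rewrite mulr_ge0 ?sin_ge0_pi//; clear -fpi f1 pi2; lra.
  have sf' : - d <= sin f'.
    have [f'pi|f'pi] := leP f' pi.
      apply: (@le_trans _ _ 0); last by apply: sin_ge0_pi; rewrite f1'.
      by clear -dd1 dd2; lra.
    rewrite (_ : f' = f' - pi + pi); last by ring.
    rewrite sinDpi lerN2; apply: le_trans (sin_le_id _) _; clear -f'pi dd2 fpi; lra.
  have d0 : 0 <= d by clear -dd1 dd2; lra.
  have : - (3/2 * d) <= r' * sin f'.
    have h1 : 0 <= r' * (sin f' + d) by rewrite mulr_ge0//; clear -sf'; lra.
    have h2 : 0 <= (3/2 - r') * d by rewrite mulr_ge0//; clear -r2'; lra.
    by clear -h1 h2; lra.
  by move: H1; rewrite ler_norml => /andP[_]; clear -sf d1 e1 m0 e0 d0; lra.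
have re3 : 3 <= rot_end R by rewrite /rot_end; clear -pi2; lra.
have z1 : 2/3 < f / rot_end R.
  by rewrite ltr_pdivlMr// /rot_end; clear -fpi; lra.
have d0 : 0 <= d by clear -dd1 dd2; lra.
have z2 : 2/3 - d / 3 <= f' / rot_end R.
  rewrite ler_pdivlMr//.
  have : (d / 3) * 3 <= (d / 3) * rot_end R by rewrite ler_wpM2l//; clear -d0; lra.
  by rewrite /rot_end; clear -dd1 fpi; lra.
move: (f / _) (f' / _) z1 z2 H2 => z z' z1 z2 H2.
have AB : `|A - B| <= m by apply: le_trans (ler_normB _ _) _; clear -A2 B2; lra.
have : (z + z') / 4 <= m + 2 * e.
  have z0 : 0 <= (z + z') / 4 by clear -z1 z2 d1 m0; lra.
  have -> : (z + z') / 4 = `|sg * ((z + z') / 4)| by rewrite normrM sgn mul1r ger0_norm.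
  rewrite (_ : sg * _ = (A - B) - (A - B - sg * ((z + z') / 4))); last by ring.
  by apply: le_trans (ler_normB _ _) _; clear -AB H2; lra.
clear -z1 z2 d0 d1 e1 e0 m0; lra.
Qed.

Section Recovery.
Context (R : realType) (p : lorenz_params R).
Hypothesis hp : admissible p.
Local Notation tau := (tau_Sigma p).
Implicit Types (a b u v : pt R) (s t w x S : R).

Lemma return_time_ge_rot b : cross_section b -> rot_end R <= return_time p b.
Proof. by move=> cb; rewrite lerDr tau_ge0. Qed.

Lemma hit_ge1 b S m : cross_section b ->
  (forall j, (j < m.+1)%N -> c1 (nth_section p b j) != 0) ->
  S + return_time p b + rot_end R * m%:R <= hit_time p S b m.+1.
Proof.
move=> cb; elim: m => [|m IH] H; first by rewrite mulr0 addr0.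
have H' j : (j < m.+1)%N -> c1 (nth_section p b j) != 0 by move=> jm; apply: H; exact: ltnW.
have := IH H'; have := return_time_ge_rot (cross_section_nth hp cb H').
rewrite -natr1 (_ : hit_time p S b m.+2 = hit_time p S b m.+1 + return_time p (nth_section p b m.+1))//.
move: (hit_time p S b m.+1) (return_time p (nth_section p b m.+1)) => A B; lra.
Qed.

Lemma hit_ge b S m : cross_section b ->
  (forall j, (j < m)%N -> c1 (nth_section p b j) != 0) -> S + m%:R <= hit_time p S b m.
Proof.
case: m => [|m] cb H; first by rewrite addr0.
apply: le_trans (hit_ge1 S cb H).
have := return_time_ge_rot cb; have : 3 <= rot_end R.
  by rewrite /rot_end; have := pi_ge2 R; lra.
rewrite -natr1; have := ler0n R m; nra.
Qed.

(** At any time the path is on its way from its last section point. Only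
    finitely many section points come before a given time because return times
    are bounded below. *)
Lemma find_visit b S t : cross_section b -> S <= t -> exists m,
  [/\ forall j, (j < m)%N -> c1 (nth_section p b j) != 0, hit_time p S b m <= t
    & c1 (nth_section p b m) != 0 -> t < hit_time p S b m.+1].
Proof.
move=> cb St.
have key n : (exists m, [/\ forall j, (j < m)%N -> c1 (nth_section p b j) != 0,
      hit_time p S b m <= t & c1 (nth_section p b m) != 0 -> t < hit_time p S b m.+1]) \/
    (forall j, (j < n)%N -> c1 (nth_section p b j) != 0) /\ hit_time p S b n <= t.
  elim: n => [|n [IH|[H1 H2]]]; [by right|by left|].
  have [b0|b0] := eqVneq (c1 (nth_section p b n)) 0.
    by left; exists n; split=> //; rewrite b0 eqxx.
  have [ht|ht] := leP (hit_time p S b n.+1) t; last by left; exists n; split.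
  right; split=> // j; rewrite ltnS leq_eqVlt => /predU1P[->//|]; exact: H1.
have [n Hn] : exists n : nat, t - S < n%:R.
  exists (Num.bound (t - S)); apply: archi_boundP; lra.
have [//|[H1 H2]] := key n.
have := hit_ge S cb H1; have := ler0n R n; lra.
Qed.

Context (k e h : R).
Hypothesis hs : small_parameters p k e h.
Context (Z : nat -> pt R).
Hypothesis Ze : forall i, `|Z i| <= e.

Definition on_first_path b s' : Prop :=
  [/\ cross_section b, 0 <= s' & c1 b != 0 -> s' <= return_time p b].

(** When the true path is in the middle of its first rotation, the
    other path is on its way from its m-th section point for some m, and
    [match_phase] matches the rotation that follows this section point. *)
Lemma survivor_visit a0 T0 b s' K : cross_section a0 -> c1 a0 != 0 ->
  0 <= mid_time p T0 a0 -> on_first_path b s' -> (obs_index h (mid_time p T0 a0) <= K)%N ->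
  (forall i, (i <= K)%N -> mid_time p T0 a0 <= i%:R * h ->
    `|flow_from p (i%:R * h - T0) a0 + Z i - flow_from p (s' + i%:R * h) b| <= e) ->
  exists m, (forall j, (j < m)%N -> c1 (nth_section p b j) != 0) /\
    survives p k e h a0 T0 Z K (nth_section p b m) (hit_time p (- s') b m).
Proof.
move=> ca a00 M0 [cb s'0 s'b] iK H.
have /andP[i1 i2] := obs_indexP hs M0.
have hs' := hs; case: hs' => k0 kr e0 ek /andP[h0 hk].
have rle := min_radius_le hp; have pi2 := pi_ge2 R.
have := H _ iK i1; have Zi := Ze (obs_index h (mid_time p T0 a0)).
move: i1 i2; set t := _ * h => i1 i2 Ht.
have sT : - s' <= t by lra.
have [m [Hm hm ht]] := find_visit cb sT.
have cm := cross_section_nth hp cb Hm.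
have flowE t' : hit_time p (- s') b m <= t' ->
    flow_from p (s' + t') b = flow_from p (t' - hit_time p (- s') b m) (nth_section p b m).
  by move=> ?; rewrite -flow_from_nth_section// opprK addrC.
have mE : mid_time p T0 a0 = T0 + tau a0 + pi / 2 by [].
have close : `|path_from p a0 (t - T0)
    - path_from p (nth_section p b m) (t - hit_time p (- s') b m)| <= 2 * e.
  move: Ht; rewrite flowE// flow_from_path//; last first.
    by move=> _; rewrite /return_time /rot_end; lra.
  rewrite (flow_from_path (a := nth_section p b m))//; last first.
    by move=> /ht /=; lra.
  move: (path_from _ _ _) (path_from _ _ _) => v u Ht.
  rewrite (_ : u - v = (u + Z (obs_index h (mid_time p T0 a0)) - v)
     - Z (obs_index h (mid_time p T0 a0))); last by rewrite addrAC addrK.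
  by apply: le_trans (ler_normB _ _) _; lra.
have [||b0 ss md] := match_phase hp hs ca cm a00 _ _ close.
- by apply/andP; split; lra.
- by move=> /ht /=; lra.
exists m; split=> //.
have md' : `|mid_time p (hit_time p (- s') b m) (nth_section p b m) - mid_time p T0 a0| <= k.
  by move: md; rewrite -normrN; congr (`|_| <= _); rewrite /mid_time; ring.
split=> // i iK' mi; rewrite -flowE; first exact: H.
move: md'; rewrite ler_norml => /andP[_]; rewrite {1}/mid_time.
have := tau_ge0 hp cm; lra.
Qed.

Definition survivors a0 T0 : set_system (pt R * R) :=
  [set Q | eventually_all p k e h a0 T0 Z (fun b S => Q (b, S))].

Lemma survivors_filter a0 T0 : Filter (survivors a0 T0).
Proof.
apply: Build_Filter => [|Q Q' HQ HQ'|Q Q' QQ'].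
- by exists 0%N.
- exact: evI HQ HQ'.
- by apply: evS => b S; exact: QQ'.
Qed.

Context (a : pt R) (s : R).
Hypothesis ca : cross_section a.
Hypothesis ga : forall n, c1 (nth_section p a n) != 0.
Hypothesis s0 : 0 < s < return_time p a.
Hypothesis sa : s != tau a.

(** The constraints of the smoothing support, for a point given as the point
    reached at time s' on the path from b. *)
Definition consistent K b s' : Prop := on_first_path b s' /\
  forall i, (i <= K)%N ->
    `|flow_from p (s + i%:R * h) a + Z i - flow_from p (s' + i%:R * h) b| <= e.

(** The part of the randomness that excludes time shifts: near the middles
    of the rotations, the third coordinate of the noise comes arbitrarily close
    to both of its extreme values. *)
Definition reaches_both_ends a0 T0 : Prop :=
  (forall d : R, 0 < d -> exists n, e - d < c3 (Z (mid_obs p h a0 T0 n))) /\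
  (forall d : R, 0 < d -> exists n, c3 (Z (mid_obs p h a0 T0 n)) < - e + d).

Definition recovered r b s' : Prop :=
  `|c1 (path_from p b s') - c1 (path_from p a s)| <= r /\
  `|c3 (path_from p b s') - c3 (path_from p a s)| <= r.

Lemma survivors_cvg a0 T0 : cross_section a0 -> (forall n, c1 (nth_section p a0 n) != 0) ->
  0 <= mid_time p T0 a0 -> reaches_both_ends a0 T0 ->
  (c1 x.1 @[x --> survivors a0 T0] --> c1 a0) /\
  (x.2 @[x --> survivors a0 T0] --> T0).
Proof.
move=> ca0 ga0 M0 [n1 n2]; have FF := survivors_filter a0 T0.
split; apply/cvgrPdist_le => r r0.
  by apply: evS (ev_close hp hs ca0 ga0 M0 Ze 0 r0) => b S; rewrite distrC.
by apply: evS (ev_start hp hs ca0 ga0 M0 Ze n1 n2 r0) => b S; rewrite distrC.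
Qed.

Lemma survivors_dist a0 T0 (g : pt R * R -> R) (l r : R) : 0 < r ->
  g x @[x --> survivors a0 T0] --> l ->
  eventually_all p k e h a0 T0 Z (fun b S => `|g (b, S) - l| <= r).
Proof.
move=> r0; have FF := survivors_filter a0 T0.
move=> /cvgrPdist_le /(_ _ r0) H.
by apply: evS H => b S; rewrite distrC.
Qed.

(** The true point has not reached the middle of its first rotation. The
    matched section point of the survivor is met at a time close to - s < 0,
    so it is the initial one, and continuity of the path in its start applies. *)
Lemma recover_before r : 0 <= mid_time p (- s) a -> reaches_both_ends a (- s) -> 0 < r ->
  exists K, forall b s', consistent K b s' -> recovered r b s'.
Proof.
move=> M0 ld r0; have FF := survivors_filter a (- s).
have [cB cS] := survivors_cvg ca ga M0 ld.
have nB : \forall x \near survivors a (- s), [/\ cross_section x.1, c1 x.1 != 0 &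
     Num.sg (c1 x.1) = Num.sg (c1 a)].
  by exists 0%N => b S [].
have cS' : - x.2 @[x --> survivors a (- s)] --> s.
  by rewrite -[X in _ --> X]opprK; exact: cvgN.
have [P1 P3] := path_cvg hp ca (ga 0) sa nB cB cS'.
have /andP[sp srt] := s0.
have s2 : 0 < s / 2 by rewrite divr_gt0.
have [K HK] := evI (evI (survivors_dist r0 P1) (survivors_dist r0 P3))
  (survivors_dist s2 cS').
exists (maxn K (obs_index h (mid_time p (- s) a))) => b s' [fb H].
have [|m [Hm sv]] := survivor_visit ca (ga 0) M0 fb (leq_maxr K _).
  by move=> i iK _; rewrite opprK (addrC _ s); exact: H.
have [/= [h1 h3] h4] := HK _ _ (survivesW (leq_maxl _ _) sv).
case: m Hm h1 h3 h4 {sv} => [|m] Hm /= h1 h3 h4.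
  by move: h1 h3; rewrite opprK => h1 h3; split.
have [cb s'0 s'b] := fb; have := hit_ge1 (- s') cb Hm.
have := s'b (Hm 0%N isT); have : 0 <= rot_end R * m%:R.
  by rewrite mulr_ge0// ltW// rot_end_gt0.
move: h4; rewrite -/(hit_time p (- s') b m.+1) ler_norml => /andP[h4 _].
move: (hit_time p (- s') b m.+1) (return_time p b) (_ * m%:R) h4 => A B C h4 g1 g2 g3.
exfalso; lra.
Qed.

(** The constraint at time 0 excludes that the initial points, at almost equal
    phases, lie in opposite lobes. *)
Lemma lobes_apart b t t' d : cross_section b -> c1 b != 0 ->
  pi / 2 <= t - tau a <= rot_end R -> 0 <= t' - tau b <= rot_end R ->
  `|(t' - tau b) - (t - tau a)| <= d -> 4 * d <= 1/3 - max_contraction p ->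
  16 * e <= 1/3 - max_contraction p ->
  `|path_from p a t - path_from p b t'| <= 2 * e ->
  Num.sg (c1 b) = Num.sg (c1 a).
Proof.
move=> cb b0 /andP[f1 f2] /andP[f1' f2'] dd d1 e1.
have pi2 := pi_ge2 R; have bm := max_contraction_ge0 p.
have ta : tau a <= t by lra.
have tb : tau b <= t' by lra.
have [a1 a2 _] := ca; have [b1 b2 _] := cb.
have half (x y : R) : `|x| <= 1/2 -> `|y| <= 1/2 -> `|x * `|y| `^ beta p| <= max_contraction p / 2.
  move=> x1 y1; have := powR_half_le (beta_gt0 hp) y1; rewrite -/(max_contraction p) => y2.
  rewrite normrM (ger0_norm (powR_ge0 _ _)).
  by rewrite mulrC ler_pM ?powR_ge0//; lra.
have A2 := half _ _ a2 a1; have B2 := half _ _ b2 b1.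
move=> /pt_norm_le[H1 H2 _]; move: H1 H2.
rewrite c1B c2B (path_rot hp ca (ga 0) ta) (path_rot hp cb b0 tb) !c1E !c2E.
have wa : 0 <= sheet_height p a <= max_height p.
  by rewrite sheet_height_ge0 sheet_height_le.
have wb : 0 <= sheet_height p b <= max_height p.
  by rewrite sheet_height_ge0 sheet_height_le.
have fr : 0 <= t - tau a <= rot_end R by apply/andP; split; lra.
have fr' : 0 <= t' - tau b <= rot_end R by rewrite f1' f2'.
have := lobe_radius_bounds hp wa fr; have := lobe_radius_bounds hp wb fr'.
set r := lobe_radius p (sheet_height p a) _.
set r' := lobe_radius p (sheet_height p b) _.
move: dd f1 f2 f1' f2' r r' {fr fr'}; move: (t - tau a) (t' - tau b) => f f'.
move=> dd f1 f2 f1' f2' r r'.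
move=> /andP[r1' r2'] /andP[r1 r2].
have sE : Num.sg (c1 b) = Num.sg (c1 a) \/ Num.sg (c1 b) = - Num.sg (c1 a).
  by have [->|->] := sgP (ga 0); have [->|->] := sgP b0; rewrite ?opprK; auto.
case: sE => // -> H1 H2; exfalso.
have sgn : `|Num.sg (c1 a)| = 1 by rewrite normr_sg (ga 0).
have e0 : 0 < e by case: hs.
have rr := min_radius_gt0 hp; have bl := max_contraction_lt hp.
apply: (opposite_lobes_apart sgn A2 B2 _ _ _ _ dd d1 e1 _ e0 H1 H2).
- by rewrite (le_trans (ltW rr)).
- by rewrite (le_trans (ltW rr)).
- by rewrite f1.
- by rewrite f1'.
- by rewrite bm.
Qed.

(** The true point is past the middle of its rotation, so its next section
    point, met at some time in (0, pi), serves as the start. The survivor meets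
    the matched section point at almost the same time, too early for a second
    return, hence its initial point is on the rotation just before. The height
    of that rotation is recovered from the section point by inverting the branch
    of the return map, which [lobes_apart] shows to be the same one. *)
Lemma recover_after r : mid_time p (- s) a < 0 -> reaches_both_ends (return_map p a) (return_time p a - s) ->
  16 * e <= 1/3 - max_contraction p -> 0 < r ->
  exists K, forall b s', consistent K b s' -> recovered r b s'.
Proof.
move=> M0 ld e1 r0; set a0 := return_map p a; set T0 := return_time p a - s.
have FF := survivors_filter a0 T0.
have ca0 : cross_section a0 by apply: cross_section_return_map => //; exact: ga 0.
have ga0 n : c1 (nth_section p a0 n) != 0 by have := ga n.+1; rewrite /nth_section iterSr.
have /andP[sp srt] := s0; have pi2 := pi_ge2 R.
have T00 : 0 < T0 by rewrite /T0; lra.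
have mE := mid_time_return p (- s) a.
have T0pi : T0 < pi by rewrite /T0; lra.
have M00 : 0 <= mid_time p T0 a0.
  by rewrite /mid_time; have := tau_ge0 hp ca0; lra.
have [cB cS] := survivors_cvg ca0 ga0 M00 ld.
have sT : s - tau a = rot_end R - T0 by rewrite /T0 /return_time; ring.
have th0 := theta_gt0 hp.
have sg2 (c : pt R) : c1 c != 0 -> Num.sg (c1 c) * Num.sg (c1 c) = 1.
  by move=> /sgP[]->; rewrite ?mulrNN mulr1.
(* The branch of the return map with the sign of c1 a, inverted: it sends the
   section point to the height of the preceding rotation. *)
pose W (x : pt R) := (Num.sg (c1 a) * c1 x + 1/2) / theta p.
have WE b : cross_section b -> c1 b != 0 -> Num.sg (c1 b) = Num.sg (c1 a) ->
    W (return_map p b) = sheet_height p b.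
  move=> cb b0 ss; rewrite /W return_mapE// c1E ss mulrA sg2 ?ga//; last exact: (ga 0).
  by field; rewrite gt_eqF.
have cW : W x.1 @[x --> survivors a0 T0] --> sheet_height p a.
  rewrite -(WE a) //; last exact: (ga 0).
  apply: cvgM; last exact: cvg_cst.
  by apply: cvgD; [apply: cvgM => //; exact: cvg_cst|exact: cvg_cst].
have cf : rot_end R - x.2 @[x --> survivors a0 T0] --> s - tau a.
  by rewrite sT; apply: cvgB => //; exact: cvg_cst.
have bl := max_contraction_lt hp.
(* The first bound keeps the matched section time positive, the second one is
   the phase error allowed when separating the lobes. *)
pose d := Num.min (T0 / 2) ((1/3 - max_contraction p) / 4).
have d0 : 0 < d by rewrite lt_min; apply/andP; split; lra.
have d1 : d <= T0 / 2 by rewrite ge_min lexx.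
have d2 : d <= (1/3 - max_contraction p) / 4 by rewrite ge_min lexx orbT.
have [K HK] := evI (evI (survivors_dist r0 (lobe_sin_cvg (p := p) cW cf))
   (survivors_dist r0 (lobe_cos_cvg (p := p) cW cf))) (survivors_dist d0 cf).
exists (maxn K (obs_index h (mid_time p T0 a0))) => b s' [fb H].
have [|m [Hm sv]] := survivor_visit ca0 (ga0 0) M00 fb (leq_maxr K _).
  move=> i iK mi; have := H i iK; rewrite (flow_from_return hp ca (ga 0)).
    suff -> : s + i%:R * h - return_time p a = i%:R * h - T0 by [].
    by rewrite /T0 opprB addrCA addrA.
  have : mid_time p T0 a0 = T0 + tau a0 + pi / 2 by [].
  have := tau_ge0 hp ca0; rewrite /T0; lra.
have [/= [h1 h3] h4] := HK _ _ (survivesW (leq_maxl _ _) sv).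
have [cb s'0 s'b] := fb.
move: h4; rewrite sT; case: m Hm h1 h3 sv => [|m] Hm h1 h3 sv.
  by rewrite /= ler_norml => /andP[h4 h5]; exfalso; lra.
have b0 := Hm 0%N isT; have cb0 : cross_section (return_map p b) by exact: cross_section_return_map.
have rE : rot_end R = 3/2 * pi by [].
case: m Hm h1 h3 sv => [|m] Hm h1 h3 sv; last first.
  have := hit_ge1 (- s') cb Hm; rewrite ler_norml => g1 /andP[g2 _].
  have : rot_end R * 1 <= rot_end R * m.+1%:R.
    by rewrite ler_pM2l ?rot_end_gt0// ler1n.
  have := s'b b0; move: (hit_time _ _ _ _) (_ * m.+1%:R) g1 g2 => A B g1 g2 g3 g4.
  exfalso; lra.
move: h1 h3; rewrite /nth_section /= -/(return_map p b) => h1 h3.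
have fE : rot_end R - (- s' + return_time p b) = s' - tau b.
  by rewrite /return_time; ring.
rewrite fE in h1 h3 *; rewrite -sT => h4.
have tb : 0 <= s' - tau b <= rot_end R.
  move: h4; rewrite ler_norml => /andP[h4 _]; apply/andP; split; first by lra.
  by have := s'b b0; rewrite /return_time; lra.
have obs0 : `|path_from p a s - path_from p b s'| <= 2 * e.
  have := H 0%N isT; rewrite mul0r !addr0 !flow_from_path_le//; last by move=> _; exact: ltW.
  move: (path_from _ _ _) (path_from _ _ _) => v u Hz.
  rewrite (_ : u - v = (u + Z 0 - v) - Z 0); last by rewrite addrAC addrK.
  by apply: le_trans (ler_normB _ _) _; have := Ze 0; lra.
have ss : Num.sg (c1 b) = Num.sg (c1 a).
  apply: (lobes_apart cb b0 _ tb h4 _ e1 obs0); last lra.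
  by apply/andP; split; lra.
have ta : tau a <= s by lra.
have tb' : tau b <= s' by lra.
rewrite /recovered (path_rot hp ca (ga 0) ta) (path_rot hp cb b0 tb') !c1E !c3E ss.
rewrite -WE//; split; last first.
  by move: h3; rewrite distrC; congr (`|_| <= r); ring.
have sgn : `|Num.sg (c1 a)| = 1 by rewrite normr_sg (ga 0).
rewrite -mulrBr normrM sgn mul1r.
by move: h1; congr (`|_| <= r); ring.
Qed.

End Recovery.

(** * Null sets from Lipschitz curves *)

Section NullSets.
Context (R : realType).
Implicit Types (x y r : R).

Lemma leb3_box (A B C : set (measurableTypeR R)) :
  measurable A -> measurable B -> measurable C ->
  leb3 R ((A `*` B) `*` C) =
  (lebesgue_measure A * lebesgue_measure B * lebesgue_measure C)%E.
Proof.
move=> mA mB mC.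
have E := @product_measure1E _ _ _ _ _ (lebesgue_measure \x lebesgue_measure)%E
  (@lebesgue_measure R) _ _ (measurableX mA mB) mC.
have E2 := @product_measure1E _ _ _ _ _ (@lebesgue_measure R) (@lebesgue_measure R)
  _ _ mA mB.
have E3 : leb3 R ((A `*` B) `*` C) = ((lebesgue_measure \x lebesgue_measure) (A `*` B) * lebesgue_measure C)%E.
  exact: E.
by rewrite E3 E2.
Qed.

Lemma measurable_box (A B C : set (measurableTypeR R)) :
  measurable A -> measurable B -> measurable C ->
  measurable ((A `*` B) `*` C : set (mpt R)).
Proof. by move=> mA mB mC; apply: measurableX => //; exact: measurableX. Qed.

Lemma plane3_negligible x : (@leb3 R).-negligible [set u : mpt R | c3 u = x].
Proof.
have mx : measurable ([set x] : set (measurableTypeR R)) by exact: measurable_set1.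
exists ((setT `*` setT) `*` [set x]); split; first exact: measurable_box.
  by rewrite leb3_box// [X in (_ * X)%E]lebesgue_measure_set1 mule0.
by move=> [[u1 u2] u3] /= <-.
Qed.

Lemma plane1_negligible x : (@leb3 R).-negligible [set u : mpt R | c1 u = x].
Proof.
have mx : measurable ([set x] : set (measurableTypeR R)) by exact: measurable_set1.
exists (([set x] `*` setT) `*` setT); split; first exact: measurable_box.
  by rewrite leb3_box// [X in (X * _ * _)%E]lebesgue_measure_set1 !mul0e.
by move=> [[u1 u2] u3] /= <-.
Qed.

(** A null cover is obtained as the intersection of covers of arbitrarily small
    measure. *)
Lemma negligible_small (d : measure_display) (T : measurableType d)
    (mu : {measure set T -> \bar R}) (N : set T) (A : nat -> set T) :
  (forall n, measurable (A n)) -> (forall n, N `<=` A n) ->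
  (forall r, 0 < r -> exists n, (mu (A n) <= r%:E)%E) -> mu.-negligible N.
Proof.
move=> mA NA muA; exists (\bigcap_n A n); split.
- exact: bigcapT_measurable.
- apply/eqP; rewrite eq_le measure_ge0 andbT.
  apply/lee_addgt0Pr => r r0; rewrite add0e.
  have [n Hn] := muA r r0; apply: le_trans Hn.
  apply: le_measure; rewrite ?inE//; first exact: bigcapT_measurable.
  by move=> x; apply.
- by move=> x Nx n _; exact: NA.
Qed.

Lemma div_small (C r : R) : 0 < r -> exists n : nat, C / n.+1%:R <= r.
Proof.
move=> r0; exists (Num.bound (`|C| / r)).
have := archi_boundP (divr_ge0 (normr_ge0 C) (ltW r0)).
set n := Num.bound _; rewrite ltr_pdivrMr// => Hn.
rewrite ler_pdivrMr// -natr1.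
have := ler_norm C; rewrite mulrDr mulr1 (mulrC r); lra.
Qed.

Definition lipschitz_to (S : R) (g : R -> R) : Prop :=
  exists2 L, 0 <= L & forall s t, 0 <= s <= S -> 0 <= t <= S ->
    `|g s - g t| <= L * `|s - t|.

(** A Lipschitz plane curve is covered by n + 2 squares with side of order 1/n,
    whose total area is of order 1/n. *)
Lemma curve_negligible (S M : R) (g1 g3 : R -> R) : 0 <= S -> 0 <= M ->
  lipschitz_to S g1 -> lipschitz_to S g3 ->
  (@leb3 R).-negligible [set u : mpt R | `|c2 u| <= M /\
    exists2 t, 0 <= t <= S & c1 u = g1 t /\ c3 u = g3 t].
Proof.
move=> S0 M0 [L1 L10 H1] [L3 L30 H3].
pose L := L1 + L3; have L0 : 0 <= L by rewrite addr_ge0.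
pose rad n : R := L * S / n.+1%:R.
pose node n j : R := S * (j%:R / n.+1%:R).
have rad0 n : 0 <= rad n by rewrite divr_ge0// mulr_ge0.
pose I x r : set (measurableTypeR R) := `[x - r, x + r]%classic.
have mI x r : measurable (I x r) by exact: measurable_itv.
have muI x r : 0 <= r -> lebesgue_measure (I x r) = (2 * r)%:E.
  move=> r0; rewrite /I lebesgue_measure_itv/= lte_fin.
  case: ltP => h; first by rewrite -EFinB; congr EFin; ring.
  by congr EFin; lra.
pose box n j : set (mpt R) := (I (g1 (node n j)) (rad n) `*` I 0 M) `*` I (g3 (node n j)) (rad n).
apply: (@negligible_small _ _ _ _ (fun n => \big[setU/set0]_(j < n.+2) box n j)).
- by move=> n; apply: bigsetU_measurable => j _; exact: measurable_box.
- move=> n [[u1 u2] u3] [/= u2M [t /andP[t0 tS] [u1E u3E]]].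
  have {}u1E : u1 = g1 t := u1E; have {}u3E : u3 = g3 t := u3E.
  have {}u2M : `|u2| <= M := u2M.
  rewrite -bigcup_mkord /=.
  have n0 : 0 < n.+1%:R :> R by rewrite ltr0n.
  have t0S : 0 <= t <= S by rewrite t0.
  have [j jn /andP[jt1 jt2]] : exists2 j : nat, (j < n.+2)%N &
      node n j <= t <= node n j + S / n.+1%:R.
    move: (S0); rewrite le_eqVlt => /predU1P[SE|Sp].
      exists 0%N => //; rewrite /node -SE !mul0r addr0.
      by move: t0 tS; rewrite -SE => -> ->.
    pose y := t * n.+1%:R / S.
    have y0 : 0 <= y by rewrite divr_ge0// mulr_ge0.
    have tE : t = S * (y / n.+1%:R) by rewrite /y; field; rewrite !gt_eqF.
    have /andP[h1 h2] := truncn_itv y0.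
    (* The index of the node just before t. *)
  exists (Num.truncn y).
      rewrite ltnS -(ler_nat R); apply: le_trans h1 _.
      by rewrite ler_pdivrMr// mulrC ler_pM2l.
    rewrite {1 2}tE /node -mulrDr; apply/andP; split.
      by rewrite ler_pM2l// ler_pM2r ?invr_gt0.
    by rewrite ler_pM2l// -[X in _ <= _ + X]mul1r -mulrDl ler_pM2r ?invr_gt0// natr1 ltW.
  have Sj : 0 <= node n j by rewrite mulr_ge0 ?divr_ge0.
  have nS : 0 <= node n j <= S by rewrite Sj (le_trans jt1).
  have dist : L * `|t - node n j| <= rad n.
    by rewrite /rad -mulrA ler_wpM2l// ger0_norm ?subr_ge0// lerBlDl.
  have d1 : `|u1 - g1 (node n j)| <= rad n.
    rewrite u1E; apply: le_trans (H1 _ _ t0S nS) _; apply: le_trans dist.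
    by rewrite ler_wpM2r// lerDl.
  have d3 : `|u3 - g3 (node n j)| <= rad n.
    rewrite u3E; apply: le_trans (H3 _ _ t0S nS) _; apply: le_trans dist.
    by rewrite ler_wpM2r// lerDr.
  exists j => //; rewrite /box /I /=; split; [split|]; rewrite in_itv/=.
  + by move: d1; rewrite ler_norml; clear; lra.
  + by rewrite sub0r add0r -ler_norml.
  + by move: d3; rewrite ler_norml; clear; lra.
- move=> r /(div_small (16 * M * (L * S) ^+ 2))[n nr]; exists n.
  apply: (@le_trans _ _ (\sum_(j < n.+2) leb3 R (box n j))%E).
    by apply: Boole_inequality => i _; exact: measurable_box.
  rewrite (eq_bigr (fun=> ((2 * rad n) * (2 * M) * (2 * rad n))%:E)); last first.
    by move=> j _; rewrite leb3_box// !muI// -!EFinM.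
  rewrite sumEFin lee_fin; apply: le_trans nr.
  rewrite sumr_const card_ord -[X in X <= _]mulr_natr.
  have n0 : 0 < n.+1%:R :> R by rewrite ltr0n.
  have -> : 2 * rad n * (2 * M) * (2 * rad n) * n.+2%:R =
      (8 * M * (L * S) ^+ 2) * (n.+2%:R / n.+1%:R) / n.+1%:R.
    by rewrite /rad; field; rewrite gt_eqF.
  rewrite ler_pM2r ?invr_gt0// (_ : 16 * M * _ = 8 * M * (L * S) ^+ 2 * 2); last by ring.
  rewrite ler_wpM2l ?mulr_ge0 ?sqr_ge0// ler_pdivrMr//.
  by rewrite -[n.+2%:R]natr1 -natr1; have := ler0n R n; lra.
Qed.
End NullSets.

(** * Generic initial points *)

Section Lipschitz.
Context (R : realType).
Implicit Types (S c : R) (f g : R -> R).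

Lemma lipschitz_cst S c : lipschitz_to S (fun=> c).
Proof. by exists 0 => // s t _ _; rewrite subrr normr0 mul0r. Qed.

Lemma lipschitz_id S : lipschitz_to S id.
Proof. by exists 1 => // s t _ _; rewrite mul1r. Qed.

Lemma lipschitzD S f g : lipschitz_to S f -> lipschitz_to S g ->
  lipschitz_to S (fun t => f t + g t).
Proof.
move=> [L L0 H] [L' L'0 H']; exists (L + L'); first exact: addr_ge0.
move=> s t hs ht; rewrite opprD addrACA mulrDl.
by apply: le_trans (ler_normD _ _) _; apply: lerD; [exact: H|exact: H'].
Qed.

Lemma lipschitz_bounded S f : lipschitz_to S f ->
  exists2 B, 0 <= B & forall t, 0 <= t <= S -> `|f t| <= B.
Proof.
move=> [L L0 H]; exists (`|f 0| + L * `|S|); first by rewrite addr_ge0// mulr_ge0.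
move=> t ht; have /andP[t0 tS] := ht.
have S0 : 0 <= (0 : R) <= S by apply/andP; split => //; exact: le_trans tS.
rewrite -[f t](subrK (f 0)) addrC; apply: le_trans (ler_normD _ _) _; rewrite lerD2l.
apply: le_trans (H _ _ ht S0) _; rewrite subr0 ler_wpM2l//.
by rewrite !ger0_norm// (le_trans t0).
Qed.

Lemma lipschitzM S f g : lipschitz_to S f -> lipschitz_to S g ->
  lipschitz_to S (fun t => f t * g t).
Proof.
move=> lf lg; have [B B0 HB] := lipschitz_bounded lf.
have [B' B'0 HB'] := lipschitz_bounded lg.
case: lf lg => [L L0 H] [L' L'0 H'].
exists (B' * L + B * L'); first by rewrite addr_ge0// mulr_ge0.
move=> s t hs ht.
rewrite (_ : f s * g s - f t * g t = g s * (f s - f t) + f t * (g s - g t)); last by ring.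
apply: le_trans (ler_normD _ _) _; rewrite mulrDl !normrM -!mulrA.
by apply: lerD; apply: ler_pM => //; [exact: HB'|exact: H|exact: HB|exact: H'].
Qed.

Lemma lipschitzN S f : lipschitz_to S f -> lipschitz_to S (fun t => - f t).
Proof.
by move=> [L L0 H]; exists L => // s t hs ht; rewrite -opprD normrN; exact: H.
Qed.

Lemma lipschitz_cos S : lipschitz_to S (@cos R).
Proof.
exists 1 => // s t _ _; rewrite mul1r.
wlog st : s t / s <= t.
  by move=> W; have [/W//|/ltW/W] := leP s t; rewrite distrC (distrC t).
move: st; rewrite le_eqVlt => /predU1P[->|st]; first by rewrite !subrr.
have [c _ ->] := cos_diff st; rewrite normrM (distrC s) ler_piMl//; exact: sin_max.
Qed.

Lemma lipschitz_sin S : lipschitz_to S (@sin R).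
Proof.
exists 1 => // s t _ _; rewrite mul1r.
wlog st : s t / s <= t.
  by move=> W; have [/W//|/ltW/W] := leP s t; rewrite distrC (distrC t).
move: st; rewrite le_eqVlt => /predU1P[->|st]; first by rewrite !subrr.
have st' : s - pi / 2 < t - pi / 2 by rewrite ltrD2r.
rewrite -(cosBpihalf s) -(cosBpihalf t).
have [c _ ->] := cos_diff st'; rewrite normrM.
rewrite (_ : t - pi/2 - (s - pi/2) = t - s); last by ring.
by rewrite (distrC s) ler_piMl//; exact: sin_max.
Qed.

Lemma lipschitz_exp S c : lipschitz_to S (fun t => expR (c * t)).
Proof.
exists (`|c| * expR (`|c| * `|S|)); first by rewrite mulr_ge0// expR_ge0.
move=> s t; wlog st : s t / s <= t.
  move=> W hs ht; have [st|/ltW st] := leP s t; first exact: W.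
  by rewrite distrC (distrC s); exact: W.
move: st; rewrite le_eqVlt => /predU1P[->|st] hs ht; first by rewrite !subrr normr0 mulr0.
have D z : z \in `]s, t[ -> is_derive z 1 (fun z => expR (c * z)) (c * expR (c * z)).
  move=> _; rewrite mulrC; apply: is_derive1_comp.
  by rewrite -[X in is_derive _ _ _ X]mulr1; apply: is_deriveZ.
have C : {within `[s, t], continuous (fun z => expR (c * z))}.
  apply: continuous_subspaceT => z.
  apply: (@continuous_comp _ _ _ (fun z => c * z) expR); last exact: continuous_expR.
  exact: mulrl_continuous.
have [z zI E] := MVT st D C.
rewrite distrC E (distrC s) !normrM ler_wpM2r// ler_wpM2l//.
rewrite (ger0_norm (expR_ge0 _)) ler_expR.
apply: le_trans (ler_norm _) _; rewrite normrM ler_wpM2l//.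
move: zI hs ht; rewrite in_itv/= => /andP[z1 z2] /andP[s0 _] /andP[_ tS].
by rewrite !ger0_norm; lra.
Qed.
End Lipschitz.

Section BadSet.
Context (R : realType) (p : lorenz_params R).
Hypothesis hp : admissible p.
Local Notation tau := (tau_Sigma p).
Implicit Types (a b u : pt R) (x s t : R).

(** All paths from section points with first coordinate x follow the same two
    curves in the plane of c1 and c3, one for each phase, while c2 stays
    bounded; for x = 0 they remain in the plane c1 = 0. *)
Lemma section_fiber_negligible x : (@leb3 R).-negligible
  [set u : mpt R | exists a s, on_path p u (a, s) /\ c1 a = x].
Proof.
have lp := lam1_gt0 hp.
have [x0|x0] := eqVneq x 0.
  apply: negligibleS (plane1_negligible 0) => u /= [a [s [[/= _ _ _ <-] ax]]].
  by rewrite /path_from ax x0 eqxx/= /lin_flow c1E ax x0 mul0r.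
pose T := (lam1 p)^-1 * ln (1 / `|x|).
pose w := `|x| `^ alpha p.
have [xle|xgt] := leP `|x| (1/2); last first.
  apply: negligibleS (@negligible_set0 _ _ _ _) => u /= [a [s [[/= [a1 _ _] _ _ _] ax]]].
  by move: xgt; rewrite -ax ltNge a1.
have T0 : 0 <= T.
  have := @tau_ge0 _ _ hp (x, 0, 1); apply.
  by split; rewrite /c1 /c2 /c3/= ?normr0//.
have N1 := @curve_negligible _ T 1 (fun t => x * expR (lam1 p * t))
  (fun t => expR (- lam3 p * t)) T0 ler01.
have re0 := rot_end_gt0 R.
have N2 := @curve_negligible _ (rot_end R) 1
  (fun s => Num.sg x * (1 + lobe_radius p w s * sin s))
  (fun s => 1 - lobe_radius p w s * cos s) (ltW re0) ler01.
have lr : lipschitz_to (rot_end R) (lobe_radius p w).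
  apply: lipschitzD; first exact: lipschitz_cst.
  apply: lipschitzM; first exact: lipschitz_cst.
  apply: lipschitzM; last exact: lipschitz_cst.
  exact: lipschitz_id.
apply: negligibleS (negligibleU (N1 _ _) (N2 _ _)).
- move=> u [a [s [[/= ca s0 sr <-] ax]]].
  have a0 : c1 a != 0 by rewrite ax.
  have {}sr := sr a0; have [a1 a2 a3] := ca.
  have TE : tau a = T by rewrite /tau_Sigma ax.
  have [st|st] := leP s (tau a).
    left; rewrite /path_from st orbT /lin_flow; split.
      rewrite c2E normrM (ger0_norm (expR_ge0 _)).
      have e1 : expR (- lam2 p * s) <= 1.
        by rewrite -expR0 ler_expR mulNr oppr_le0 mulr_ge0// ltW// lam2_gt0.
      apply: (@le_trans _ _ (1 * 1)); last by rewrite mulr1.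
      by rewrite ler_pM// ?expR_ge0//; lra.
    by exists s; [rewrite s0 -TE|rewrite c1E c3E ax a3 mul1r].
  right; rewrite (path_rot hp ca a0 (ltW st)); split; last first.
    exists (s - tau a); last by rewrite c1E c3E ax /sheet_height ax.
    by move: sr; rewrite /return_time; lra.
  rewrite c2E; apply: le_trans (ler_normB _ _) _.
  have := powR_half_le (beta_gt0 hp) a1; have := max_contraction_lt hp; rewrite -/(max_contraction p).
  have b0 := powR_ge0 `|c1 a| (beta p).
  have sg1 : `|Num.sg (c1 a)| = 1 by rewrite normr_sg a0.
  rewrite !normrM sg1 (ger0_norm b0) mul1r (ger0_norm (x := 4^-1))// => b1 b2.
  have h1 : `|c2 a| * `|c1 a| `^ beta p <= 1/2 * (1/3) by rewrite ler_pM//; lra.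
  have h2 : `|s - tau a| * `|(rot_end R)^-1| <= 1.
    rewrite -normrM ger0_norm; last by rewrite divr_ge0 ?subr_ge0 ?ltW.
    by rewrite ler_pdivrMr// mul1r; move: sr; rewrite /return_time; lra.
  have : 4^-1 * (`|s - tau a| * `|(rot_end R)^-1|) <= 4^-1 * 1 by rewrite ler_pM2l.
  lra.
- apply: lipschitzM; [exact: lipschitz_cst|exact: lipschitz_exp].
- exact: lipschitz_exp.
- apply: lipschitzM; first exact: lipschitz_cst.
  apply: lipschitzD; first exact: lipschitz_cst.
  by apply: lipschitzM => //; exact: lipschitz_sin.
- apply: lipschitzD; first exact: lipschitz_cst.
  by apply: lipschitzN; apply: lipschitzM => //; exact: lipschitz_cos.
Qed.

(** The only point that the branches of the one-dimensional return map named by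
    a word (true for x > 0) can send to 0; there are countably many words. *)
Fixpoint gamma_preimage (w : seq bool) : R :=
  if w is c :: w' then
    let sg := if c then 1 else -1 in
    sg * ((sg * gamma_preimage w' + 1/2) / theta p) `^ (alpha p)^-1
  else 0.

Lemma gamma_preimageP n a : cross_section a ->
  (forall j, (j < n)%N -> c1 (nth_section p a j) != 0) -> c1 (nth_section p a n) = 0 ->
  exists w, c1 a = gamma_preimage w.
Proof.
elim: n a => [|n IH] a ca H an; first by exists [::].
have a0 : c1 a != 0 := H 0%N isT.
have [|||w Hw] := IH (return_map p a).
- exact: cross_section_return_map.
- by move=> j jn; have := H j.+1 jn; rewrite /nth_section iterSr.
- by move: an; rewrite /nth_section iterSr.
exists ((0 < c1 a) :: w) => /=; rewrite -Hw return_mapE// c1E.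
have th0 := theta_gt0 hp; have a_gt := alpha_gt0 hp.
have sgE : (if 0 < c1 a then 1 else -1) = Num.sg (c1 a) :> R.
  by case: sgrP a0 => //; rewrite ltxx.
rewrite sgE mulrA (_ : Num.sg (c1 a) * Num.sg (c1 a) = 1); last first.
  by have [->|->] := sgP a0; rewrite ?mulrNN mulr1.
have -> : (1 * (theta p * sheet_height p a - 1 / 2) + 1 / 2) / theta p = sheet_height p a.
  by field; rewrite gt_eqF.
rewrite /sheet_height -powRrM divff ?gt_eqF//.
by rewrite powRr1// -numEsg.
Qed.

Definition generic_start a s : Prop :=
  [/\ cross_section a, forall n, c1 (nth_section p a n) != 0, 0 < s < return_time p a & s != tau a].

(** The exclusion of c3 = 1 removes the points on the cross-section, that of
    |c1| = 1 the points on Sigma. *)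
Lemma generic_ae : {ae (@leb3 R), forall u : pt R,
  forall a s, on_path p u (a, s) -> generic_start a s}.
Proof.
pose F i : set (mpt R) := if (unpickle i : option (seq bool)) is Some w then
  [set u | exists a s, on_path p u (a, s) /\ c1 a = gamma_preimage w] else set0.
have NF : (@leb3 R).-negligible (\bigcup_i F i).
  apply: negligible_bigcup => i; rewrite /F; case: unpickle => [w|].
    exact: section_fiber_negligible.
  exact: negligible_set0.
have N := negligibleU (negligibleU (plane3_negligible (1 : R)) NF)
  (negligibleU (plane1_negligible (1 : R)) (plane1_negligible (-1 : R))).
apply: negligibleS N => u /= Hu; apply: contrapT => Nu; apply: Hu => a s ons.
have [/= ca s0 sr us] := ons.
have u3 : c3 u != 1 by apply/eqP => u3; apply: Nu; left; left.
have u1 : `|c1 u| != 1.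
  apply/eqP => u1; apply: Nu; right; have [u10|u10] := leP 0 (c1 u).
    by left; rewrite -u1 ger0_norm.
  by right; rewrite /= -u1 ltr0_norm ?opprK.
have FN w : c1 a != gamma_preimage w.
  apply/eqP => aw; apply: Nu; left; right; exists (pickle w) => //.
  by rewrite /F pickleK; exists a, s.
have ga n : c1 (nth_section p a n) != 0.
  apply/negP => an0; pose P n := c1 (nth_section p a n) == 0.
  have exP : exists n, P n by exists n.
  case: (ex_minnP exP) => m /eqP m0 mmin.
  have [j jm|w /eqP] := gamma_preimageP ca _ m0; last by rewrite (negbTE (FN w)).
  by apply/negP => /(mmin j); rewrite leqNgt jm.
have a0 := ga 0%N; have {}sr := sr a0.
have [_ _ a3] := ca.
split=> //.
  apply/andP; split; rewrite lt_neqAle ?s0 ?sr ?andbT.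
    apply/eqP => se; move: u3; rewrite -us -se path_from0// => /eqP[]; exact: a3.
  by apply/eqP => se; move: u3; rewrite -us se -/(return_map p a) return_mapE// c3E eqxx.
apply/eqP => se; move: u1; rewrite -us /path_from se lexx orbT lin_tau_Sigma//.
  by rewrite c1E normr_sg a0 eqxx.
exact: lam1_gt0.
Qed.
End BadSet.

(** * Almost sure behaviour of the noise *)

Section Noise.
Context (R : realType) (d : measure_display) (Om : measurableType d).
Context (P : probability Om R) (Z : nat -> {RV P >-> mpt R}).

Lemma measurable_noise j (A : set (mpt R)) : measurable A -> measurable (Z j @^-1` A).
Proof. by move=> mA; rewrite -[_ @^-1` _]setTI; exact: (measurable_funP (Z j)). Qed.

(** The probability that n independent variables all miss D is the n-th power of
    a number less than 1. *)
Lemma iid_hits (f : pt R -> R) (D : set (mpt R)) (M : nat -> nat) :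
  iid_with_density Z f -> measurable D -> (0 < \int[@leb3 R]_(z in D) (f z)%:E)%E ->
  injective M -> {ae P, forall om, exists n, D (Z (M n) om)}.
Proof.
move=> [indep dens] mD D0 injM.
pose C := ~` D; have mC : measurable C by exact: measurableC.
pose q := fine (P (Z 0 @^-1` C)).
have qE j : P (Z j @^-1` C) = q%:E.
  rewrite /q fineK ?fin_num_measure//; last exact: measurable_noise.
  by rewrite !dens.
have q0 : 0 <= q by rewrite fine_ge0.
have q1 : q < 1.
  have : P (Z 0 @^-1` C) = (1 - P (Z 0 @^-1` D))%E.
    by rewrite /C preimage_setC probability_setC//; exact: measurable_noise.
  rewrite qE => E; rewrite -lte_fin E dens//.
  have : (\int[@leb3 R]_(z in D) (f z)%:E)%E \is a fin_num.
    by rewrite -(dens 0%N)// fin_num_measure//; exact: measurable_noise.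
  move: D0; case: (integral _ _ _) => //= x x0 _.
  by rewrite lte_fin in x0; rewrite -EFinB lte_fin; lra.
pose J n := [seq M i | i <- iota 0 n].
apply: (@negligible_small _ _ _ _ _ (fun n => \bigcap_(j in [set` J n]) (Z j @^-1` C))).
- move=> n; apply: fin_bigcap_measurable; first exact: finite_seq.
  by move=> j _; exact: measurable_noise.
- move=> n om /= Hom j /mapP[i _ ->] /= Dj; apply: Hom; by exists i.
- move=> r r0.
  have := @cvg_expr R q; rewrite ger0_norm// => /(_ q1) /cvgrPdist_le /(_ _ r0)[n _ Hn].
  have uJ : uniq (J n) by rewrite map_inj_uniq// iota_uniq.
  have E : P (\bigcap_(j in [set` J n]) (Z j @^-1` C)) =
      (\prod_(j <- J n) P (Z j @^-1` C))%E := indep (J n) (fun=> C) uJ (fun=> mC).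
  exists n; suff H : (\prod_(j <- J n) P (Z j @^-1` C) <= r%:E)%E.
    by rewrite -E in H; exact: H.
  have := Hn n (leqnn n); rewrite /= sub0r normrN ger0_norm ?exprn_ge0// => le.
  rewrite (eq_bigr (fun=> q%:E)); last by move=> j _; exact: qE.
  rewrite prodEFin lee_fin big_map (_ : iota 0 n = index_iota 0 n); last first.
    by rewrite /index_iota subn0.
  by rewrite prodr_const_nat subn0.
Qed.

Definition slab (e : R) (C : set (measurableTypeR R)) : set (mpt R) :=
  (`[-e, e]%classic `*` `[-e, e]%classic) `*` C.

Lemma measurable_slab e C : measurable C -> measurable (slab e C).
Proof.
by move=> mC; apply: measurable_box => //; exact: measurable_itv.
Qed.

Lemma ball_box (e : R) : [set z : mpt R | `|(z : pt R)| <= e] = slab e `[-e, e].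
Proof.
rewrite /slab; apply/seteqP; split => [[[x y] z]|[[x y] z]] /=.
  by move=> /pt_norm_le[]; rewrite c1E c2E c3E !in_itv/= -!ler_norml.
by rewrite !in_itv/= -!ler_norml => -[[h1 h2] h3]; apply/pt_norm_le.
Qed.

Lemma noise_bounded (e : R) : iid_with_density Z (eta e) ->
  {ae P, forall om, forall i, `|(Z i om : pt R)| <= e}.
Proof.
move=> [_ dens]; apply: ae_foralln => i.
have mA : measurable ([set z : mpt R | `|(z : pt R)| <= e]).
  by rewrite ball_box; apply: measurable_slab; exact: measurable_itv.
exists (Z i @^-1` ~` [set z : mpt R | `|(z : pt R)| <= e]); split.
- by apply: measurable_noise; exact: measurableC.
- have E := dens i _ (measurableC mA); apply: etrans E _.
  apply: integral0_eq => z /= /negP zD.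
  by rewrite /eta (negbTE zD).
- by [].
Qed.

Lemma integral_eta_gt0 (e : R) (C : set (measurableTypeR R)) : 0 < e -> measurable C ->
  C `<=` `[-e, e]%classic -> (0 < lebesgue_measure C)%E ->
  (0 < \int[@leb3 R]_(z in slab e C) (eta e z)%:E)%E.
Proof.
move=> e0 mC Ce C0.
have mI : measurable (`[-e, e]%classic : set (measurableTypeR R)) by exact: measurable_itv.
have mD := measurable_slab e mC.
pose c : R := ((2 * e) ^+ 3)^-1.
have c0 : 0 < c by rewrite invr_gt0 exprn_gt0// mulr_gt0.
rewrite (eq_integral (fun=> c%:E)); last first.
  move=> z; rewrite inE => -[z12 z3].
  have : [set z : mpt R | `|(z : pt R)| <= e] z by rewrite ball_box; split => //; exact: Ce.
  by rewrite /eta /= => ->.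
rewrite integral_cst// mule_gt0// leb3_box//.
pose I : set (measurableTypeR R) := `[-e, e]%classic.
have I0 : (0 < lebesgue_measure I)%E.
  rewrite /I lebesgue_measure_itv/= lte_fin; rewrite ifT; last by lra.
  by rewrite -EFinB lte_fin; lra.
by rewrite !mule_gt0.
Qed.

(** For each l, the noise falls in the top slab of thickness e / (l + 1) of the
    cube at one of the times M n, almost surely; likewise for the bottom. *)
Lemma noise_loud (e : R) (M : nat -> nat) : 0 < e -> iid_with_density Z (eta e) ->
  injective M -> {ae P, forall om,
   (forall r : R, 0 < r -> exists n, e - r < c3 (Z (M n) om)) /\
   (forall r : R, 0 < r -> exists n, c3 (Z (M n) om) < - e + r)}.
Proof.
move=> e0 hZ injM.
have lsmall (r : R) : 0 < r -> exists l : nat, e / l.+1%:R <= r by exact: div_small.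
have el0 l : 0 < e / l.+1%:R by rewrite divr_gt0.
have ele l : e / l.+1%:R <= e by rewrite ler_pdivrMr// ler_pMr// ler1n.
have T l : {ae P, forall om, exists n, e - e / l.+1%:R < c3 (Z (M n) om)}.
  pose C : set (measurableTypeR R) := `]e - e / l.+1%:R, e]%classic.
  have mC : measurable C by exact: measurable_itv.
  have := @iid_hits _ _ M hZ (measurable_slab e mC)
    (@integral_eta_gt0 e C e0 mC _ _) injM.
  move=> H; apply: filterS (H _ _).
  - by move=> om [n [_ ]]; rewrite /C /= in_itv/= => /andP[h _]; exists n.
  - by move=> x; rewrite /C /= !in_itv/= => /andP[h ->]; rewrite andbT; have := ele l; move: (e / _) h => r; lra.
  - rewrite /C lebesgue_measure_itv/= lte_fin; have := el0 l; move: (e / _) => r h.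
    rewrite ifT; last by lra.
    by rewrite -EFinB lte_fin; lra.
have B l : {ae P, forall om, exists n, c3 (Z (M n) om) < - e + e / l.+1%:R}.
  pose C : set (measurableTypeR R) := `[- e, - e + e / l.+1%:R[%classic.
  have mC : measurable C by exact: measurable_itv.
  have := @iid_hits _ _ M hZ (measurable_slab e mC)
    (@integral_eta_gt0 e C e0 mC _ _) injM.
  move=> H; apply: filterS (H _ _).
  - by move=> om [n [_ ]]; rewrite /C /= in_itv/= => /andP[_ h]; exists n.
  - by move=> x; rewrite /C /= !in_itv/= => /andP[-> h] /=; have := ele l; move: (e / _) h => r; lra.
  - rewrite /C lebesgue_measure_itv/= lte_fin; have := el0 l; move: (e / _) => r h.
    rewrite ifT; last by lra.
    by rewrite -EFinB lte_fin; lra.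
apply: filterS2 (ae_foralln T) (ae_foralln B) => om HT HB; split=> r r0.
  have [l lr] := lsmall r r0; have [n Hn] := HT l; exists n.
  by apply: le_lt_trans Hn; rewrite lerD2l lerN2.
have [l lr] := lsmall r r0; have [n Hn] := HB l; exists n.
by apply: lt_le_trans Hn _; rewrite lerD2l.
Qed.
End Noise.

(** * Convergence of the smoothing supports *)

Section Distance.
Context (R : realType).
Implicit Types (u v : pt R).

Lemma enorm_le u : enorm u <= `|c1 u| + `|c2 u| + `|c3 u|.
Proof.
rewrite /enorm; have h : 0 <= `|c1 u| + `|c2 u| + `|c3 u| by rewrite !addr_ge0.
rewrite -(ger0_norm h) -sqrtr_sqr ler_wsqrtr//.
rewrite -(real_normK (num_real (c1 u))) -(real_normK (num_real (c2 u))).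
rewrite -(real_normK (num_real (c3 u))).
have := normr_ge0 (c1 u); have := normr_ge0 (c2 u); have := normr_ge0 (c3 u).
move: `|c1 u| `|c2 u| `|c3 u| => x y z z0 y0 x0.
have := mulr_ge0 x0 y0; have := mulr_ge0 x0 z0; have := mulr_ge0 y0 z0.
rewrite !expr2; lra.
Qed.

(** The set U is open in the second coordinate, so the point with second
    coordinate c2 v may lie just outside of it; pulling c2 v slightly towards
    c2 u brings it inside. *)
Lemma dist_neighborhood_U u v (e r : R) : 0 < e -> 0 < r ->
  `|c1 v - c1 u| <= r -> `|c3 v - c3 u| <= r -> `|c2 v - c2 u| <= 2 * e ->
  dist_to v (neighborhood_U u e) <= 3 * r.
Proof.
move=> e0 r0 h1 h3 h2.
(* Positive, and small enough that moving by the fraction l of 2 e costs at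
   most r. *)
pose l := r / (2 * e + r).
have er0 : 0 < 2 * e + r by lra.
have l0 : 0 < l by rewrite divr_gt0.
have l1 : l * (2 * e) <= r.
  by rewrite /l mulrAC ler_pdivrMr// ler_pM2l//; lra.
have l2 : l <= 1 by rewrite ler_pdivrMr// mul1r; lra.
pose w : pt R := (c1 u, c2 v - l * (c2 v - c2 u), c3 u).
have wU : neighborhood_U u e w.
  split => //; rewrite c2E.
  rewrite (_ : _ - _ - _ = (1 - l) * (c2 v - c2 u)); last by ring.
  rewrite normrM ger0_norm; last by lra.
  have : (1 - l) * `|c2 v - c2 u| <= (1 - l) * (2 * e) by rewrite ler_wpM2l//; lra.
  have : 0 < l * (2 * e) by rewrite mulr_gt0 // mulr_gt0.
  lra.
apply: (@le_trans _ _ (enorm (v - w))).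
  apply: ge_inf; last by exists w.
  by exists 0 => _ [z _ <-]; exact: sqrtr_ge0.
apply: le_trans (enorm_le _) _; rewrite c1B c2B c3B c1E c2E c3E.
rewrite (_ : c2 v - (c2 v - _) = l * (c2 v - c2 u)); last by ring.
have : `|l * (c2 v - c2 u)| <= r.
  by rewrite normrM (ger0_norm (ltW l0)); apply: le_trans l1; rewrite ler_pM2l.
lra.
Qed.

Lemma squeeze_ereal0 (f : nat -> \bar R) :
  (forall r : R, 0 < r -> exists K, forall k, (K <= k)%N -> (0 <= f k <= r%:E)%E) ->
  f @ \oo --> 0%E.
Proof.
move=> H; apply/fine_cvgP; split.
  have [K HK] := H 1 ltr01; exists K => // k /= /HK /andP[f0 f1].
  by rewrite ge0_fin_numE// (le_lt_trans f1)// ltry.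
apply/cvgrPdist_le => r r0; have [K HK] := H r r0.
exists K => // k /= /HK /andP[f0 f1].
rewrite sub0r normrN ger0_norm ?fine_ge0// -lee_fin fineK//.
by rewrite ge0_fin_numE// (le_lt_trans f1)// ltry.
Qed.
End Distance.

Section Smoothing.
Context (R : realType) (p : lorenz_params R).
Hypothesis hp : admissible p.
Local Notation tau := (tau_Sigma p).

(** Distinct rotations are observed at distinct times, so independence of the
    noise applies along [mid_obs]. *)
Lemma mid_obs_inj (k e h : R) (a : pt R) (T : R) : small_parameters p k e h ->
  cross_section a -> (forall n, c1 (nth_section p a n) != 0) -> 0 <= mid_time p T a ->
  injective (mid_obs p h a T).
Proof.
move=> hs ca ga M0.
have step n : (mid_obs p h a T n < mid_obs p h a T n.+1)%N.
  have hs' := hs; case: hs' => k0 kr e0 ek /andP[h0 hk].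
  have /andP[_ i2] := obs_indexP hs (nth_mid_ge0 hp ca ga M0 n).
  have /andP[i3 _] := obs_indexP hs (nth_mid_ge0 hp ca ga M0 n.+1).
  rewrite -(ltr_nat R) -(ltr_pM2r h0).
  apply: lt_le_trans i3; apply: lt_le_trans i2 _.
  have := nth_mid_mono hp T ca ga n; have := pi_ge2 R; have := min_radius_le hp; lra.
move: (mid_obs p h a T) step => f step i j ij.
have mono := homo_ltn ltn_trans step.
by case: (ltngtP i j) => // /mono; rewrite ij ltnn.
Qed.

(** The second bound on the noise level serves to separate the lobes. *)
Lemma small_parameters_exist : exists k h e : R, 0 < h /\ 0 < e /\ forall e' h' : R,
  0 < e' -> e' <= e -> 0 < h' -> h' <= h ->
  small_parameters p k e' h' /\ 16 * e' <= 1/3 - max_contraction p.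
Proof.
have rr := min_radius_gt0 hp; have rle := min_radius_le hp; have bl := max_contraction_lt hp.
have pi2 := pi_ge2 R.
pose k := min_radius p / 8.
have k0 : 0 < k by rewrite divr_gt0.
have s0 : 0 < min_radius p ^+ 2 * sin k.
  rewrite mulr_gt0 ?exprn_gt0// sin_gt0_pi// k0/= /k; lra.
exists k, k, (Num.min (min_radius p ^+ 2 * sin k / 6) ((1/3 - max_contraction p) / 16)).
split=> //; split.
  by rewrite lt_min; apply/andP; split; lra.
move=> e h e0; rewrite le_min => /andP[e1 e2] h0 hk; split; last by lra.
by split; rewrite ?h0 //; lra.
Qed.

(** Whichever representation of u by a path was chosen, the flow of u is the
    flow from its section point. *)
Lemma geo_on_path u : Lambda p u -> exists a s, on_path p u (a, s) /\
  forall t, geo p t u = flow_from p (s + t) a.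
Proof.
move=> /(@xgetPex _ (u, 0)); rewrite /geo; case: (xget _ _) => a s H.
by exists a, s.
Qed.

Lemma on_path_first u a s : on_path p u (a, s) ->
  on_first_path p a s /\ flow_from p s a = u.
Proof.
move=> [/= ca s0 sr us]; split; first by split.
by rewrite (flow_from_path_le hp ca sr).
Qed.

End Smoothing.

Theorem theorem2p5 (R : realType) (p : lorenz_params R) (q : pt R -> R)
    (hp : admissible p) (hq : prior_density p q) :
  exists hmax epsmax : R, 0 < hmax /\ 0 < epsmax /\
  forall eps h : R, 0 < eps -> eps <= epsmax -> 0 < h -> h <= hmax ->
  forall (d : measure_display) (Om : measurableType d) (P : probability Om R)
    (Z : nat -> {RV P >-> mpt R}),
  iid_with_density Z (eta eps) ->
  {ae (@leb3 R), forall u : pt R, Lambda p u ->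
    {ae P, forall om : Om,
      (fun k : nat =>
         sup_dist
           (smoothing_support p q eps h
              (fun i : nat => geo p (i%:R * h) u + Z i om) k)
           (neighborhood_U u eps)) @ \oo --> 0%E}}.
Proof.
have [k [hmax [emax [hm0 [em0 Hsmall]]]]] := small_parameters_exist hp.
exists hmax, emax; split=> //; split=> // eps h e0 ee h0 hh d Om P Z iid.
have [hs e16] := Hsmall eps h e0 ee h0 hh.
apply: negligibleS (generic_ae hp) => u /= Hu; apply: contra_not Hu => gen /(geo_on_path)[a [s [ons geou]]].
have [ca ga s0 sa] := gen a s ons.
have [_ usE] := on_path_first hp ons.
have [_ _ _ /= pathu] := ons.
suff [a0 [T0 [ca0 ga0 M0 rec]]] : exists a0 T0, [/\ cross_section a0,
    forall n, c1 (nth_section p a0 n) != 0, 0 <= mid_time p T0 a0 &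
    forall Z' : nat -> pt R, (forall i, `|Z' i| <= eps) -> reaches_both_ends p eps h Z' a0 T0 ->
    forall r, 0 < r -> exists K, forall b s',
      consistent p eps h Z' a s K b s' -> recovered p a s r b s'].
  have injM := mid_obs_inj hp hs ca0 ga0 M0.
  apply: filterS2 (noise_bounded iid) (noise_loud e0 iid injM) => om Ze ld.
  apply: squeeze_ereal0 => r r0.
  have r3 : 0 < r / 3 by rewrite divr_gt0.
  have [K HK] := rec (fun i => Z i om) Ze ld _ r3.
  exists K => n Kn; apply/andP; split.
    by apply: ereal_sup_ubound; left.
  apply: ge_ereal_sup => _ [->|[v + <-]]; first by rewrite lee_fin ltW.
  rewrite smoothing_supportE// => -[Lv _ obs].
  have [b [s' [onb geov]]] := geo_on_path Lv.
  have [fb vE] := on_path_first hp onb.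
  have [_ _ _ /= pathv] := onb.
  have {}obs i : (i <= n)%N ->
      `|flow_from p (s + i%:R * h) a + Z i om - flow_from p (s' + i%:R * h) b| <= eps.
    by move=> /obs; rewrite geou geov.
  have [] := HK b s'.
    by split=> // i iK; apply: obs; exact: leq_trans Kn.
  rewrite pathu pathv => h1 h3.
  have h2 : `|c2 v - c2 u| <= 2 * eps.
    have := obs 0%N isT; rewrite mul0r !addr0 usE vE => /pt_norm_le[_ + _].
    have /pt_norm_le[_ z2 _] := Ze 0%N.
    rewrite c2B (_ : c2 (u + Z 0 om) = c2 u + c2 (Z 0 om))// => z3.
    rewrite (_ : c2 v - c2 u = c2 (Z 0 om) - (c2 u + c2 (Z 0 om) - c2 v)); last by ring.
    by apply: le_trans (ler_normB _ _) _; lra.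
  rewrite lee_fin; apply: le_trans (dist_neighborhood_U e0 r3 h1 h3 h2) _; lra.
have [M0|M0] := leP 0 (mid_time p (- s) a).
  exists a, (- s); split=> // Z' Ze ld r r0.
  exact: (recover_before hp hs Ze ca ga s0 sa M0 ld r0).
exists (return_map p a), (return_time p a - s); split.
- by apply: cross_section_return_map => //; exact: (ga 0).
- by move=> n; have := ga n.+1; rewrite /nth_section iterSr.
- have cr : cross_section (return_map p a) by apply: cross_section_return_map => //; exact: (ga 0).
  rewrite /mid_time; have := tau_ge0 hp cr; have := pi_ge2 R; move/andP: s0 => [_ s1]; lra.
- move=> Z' Ze ld r r0.
  exact: (recover_after hp hs Ze ca ga s0 M0 ld e16 r0).
Qed.
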